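(* Fix an $A|B$ bipartition with $n_A=n_B=\frac n2$, let $m:\mathbb N\to\mathbb N$ satisfy $m(n_A)=\omega(\log n_A)$, and let $k=k(n)\in\mathrm{poly}(n)$. Then there exists a family of $n$-qubit mixed states $\{\rho_n\}_n$ such that $$H_{\min}(A^k|B^k)_{\rho_n^{\otimes k}}\le-k\,(n_A-m(n_A))+\mathrm{negl}(n),\qquad\overset{c}{H}_{\min}(A^k|B^k)_{\rho_n^{\otimes k}}\ge k\,n_A-\mathrm{negl}(n).$$
   Context: $\log$ is base $2$; $n$ ranges over even integers, $A$ and $B$ consist of $n_A$ and $n_B$ qubits. $f=\omega(g)$ means $f/g\to\infty$; $\mathrm{negl}(n)$ denotes a function that is $o(n^{-c})$ for every fixed $c$. The conditional min-entropy is $H_{\min}(A|B)_\rho:=-\inf_{\sigma_B\ge0,\mathrm{Tr}\sigma_B=1}\log\inf\{\lambda\ge0:\rho_{AB}\le\lambda\,\mathbb 1_A\otimes\sigma_B\}$ (positive semidefinite order). Computational version: fix a finite gate set $\mathcal G$ (each gate is a unitary acting on a bounded number of registers) and a polynomial $p$; these are fixed before the family of states is chosen. For systems $A,B$, $d_A=\dim\mathcal H_A$, $A'\cong A$, $|\Omega_{AA'}\rangle=\frac1{\sqrt{d_A}}\sum_x|x\rangle_A|x\rangle_{A'}$. For a CPTP map $T:\mathcal B(\mathcal H_B)\to\mathcal B(\mathcal H_{A'})$ with adjoint $T^*$, the gate complexity $C(T)$ is the minimal number of gates from $\mathcal G$ in a unitary circuit $U:\mathcal H_B\otimes\mathcal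 H_E\to\mathcal H_{A'}\otimes\mathcal H_K$ (for some ancillary systems $E,K$ of matching total dimension) such that $T(\rho)=\mathrm{tr}_K[U(\rho\otimes|0\rangle\langle0|_E)U^*]$. The Choi operator is $J(T^* ):=d_A(\mathrm{Id}_A\otimes T^* )(|\Omega_{AA'}\rangle\langle\Omega_{AA'}|)$. Let $\mathbf J:=\{J(T^* ):C(T)\le p(n)\}$ and $\mathcal C^E:=\mathrm{cone}(\mathbf J)$ (smallest convex cone), with the standing assumption $\mathrm{span}_{\mathbb R}\mathbf J=\{X\text{ Hermitian on }AB:\mathrm{tr}_AX\in\mathbb R\mathbb 1_B\}$. Write $X\le_SY$ iff $\mathrm{Tr}[XF]\le\mathrm{Tr}[YF]$ for all $F\in\mathcal C^E$. Then $$\overset{c}{D}{}^{A|B}_{\max}(\rho\|\sigma):=\inf\{\lambda\in\mathbb R:\rho\le_S2^\lambda\sigma\},\qquad\overset{c}{H}_{\min}(A|B)_\rho:=-\inf_{\sigma_B\ge0,\mathrm{Tr}\sigma_B=1}\overset{c}{D}{}^{A|B}_{\max}(\rho_{AB}\|\mathbb 1_A\otimes\sigma_B);$$ equivalently $\overset{c}{H}_{\min}(A|B)_\rho=-\log\bigl(d_A\max_{T:C(T)\le p(n)}\langle\Omega_{AA'}|(\mathrm{Id}_A\otimes T)(\rho_{AB})|\Omega_{AA'}\rangle\bigr)$. The quantities with $A^k,B^k$ are these definitions applied to $k$ copies of the systems and the state $\rho_n^{\otimes k}$, with channels $T:B^k\to A'^k$ satisfying $C(T)\le p(n)$. *)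

(* Defs.v *)
From HB Require Import structures.
From mathcomp Require Import all_boot all_order all_algebra.
From mathcomp Require Import complex.
From mathcomp Require Import all_classical all_reals all_analysis.
Import Order.TTheory GRing.Theory Num.Theory.
Import numFieldNormedType.Exports.

Set Implicit Arguments.
Unset Strict Implicit.
Unset Printing Implicit Defensive.

Local Open Scope classical_set_scope.
Local Open Scope complex_scope.
Local Open Scope sesquilinear_scope.
Local Open Scope ring_scope.

(** * Operators between finite-dimensional systems

A system is given by a finite type [X] labelling its orthonormal
("computational") basis.  The tensor product of [X] and [Y] is [X * Y]. *)

(* Linear operators from the system [X] to the system [Y]. *)
Definition op (R : realType) (X Y : finType) := 'M[R[i]]_(#|Y|, #|X|).

Section Operators.
Variable R : realType.
Implicit Types X Y Z : finType.

(* The matrix element <y|M|x>. *)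
Definition ent X Y (M : op R X Y) (y : Y) (x : X) : R[i] :=
  M (enum_rank y) (enum_rank x).

Definition mkop X Y (F : Y -> X -> R[i]) : op R X Y :=
  \matrix_(i, j) F (enum_val i) (enum_val j).

Definition tens X1 Y1 X2 Y2 (M : op R X1 Y1) (N : op R X2 Y2) :
    op R (X1 * X2)%type (Y1 * Y2)%type :=
  mkop (fun y x => ent M y.1 x.1 * ent N y.2 x.2).

Definition ptr_left X Y (M : op R (X * Y)%type (X * Y)%type) : op R Y Y :=
  mkop (fun y y' => \sum_(x : X) ent M (x, y) (x, y')).

Definition ptr_right X Y (M : op R (X * Y)%type (X * Y)%type) : op R X X :=
  mkop (fun x x' => \sum_(y : Y) ent M (x, y) (x', y)).

Definition selfadjoint X (M : op R X X) : Prop := M ^t* = M.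

Definition psd X (M : op R X X) : Prop :=
  selfadjoint M /\ forall v : 'cV[R[i]]_#|X|, 0 <= (v ^t* *m M *m v) 0 0.

Definition psd_le X (M N : op R X X) : Prop := psd (N - M).

Definition density X (M : op R X X) : Prop := psd M /\ \tr M = 1.

(** ** Superoperators *)

(* Id_Z (x) T, acting on operators on [Z * X] by applying [T] to each block
   (<z| (x) 1) M (|z'> (x) 1). *)
Definition id_tens Z X Y (T : op R X X -> op R Y Y)
    (M : op R (Z * X)%type (Z * X)%type) : op R (Z * Y)%type (Z * Y)%type :=
  mkop (fun a b =>
    ent (T (mkop (fun x x' => ent M (a.1, x) (b.1, x')))) a.2 b.2).

Definition cptp X Y (T : op R X X -> op R Y Y) : Prop :=
  [/\ (forall (c : R[i]) M N, T (c *: M + N) = c *: T M + T N),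
      (forall Z M, psd M -> psd (@id_tens Z X Y T M)) &
      (forall M, \tr (T M) = \tr M)].

(* The adjoint for the Hilbert-Schmidt product <M, N> = tr (M^* N): its
   (i, j) entry is <E_ij, T^* N> = <T E_ij, N> for the matrix unit E_ij. *)
Definition adjoint X Y (T : op R X X -> op R Y Y) (N : op R Y Y) : op R X X :=
  \matrix_(i, j) \tr ((T (delta_mx i j)) ^t* *m N).

(* |Omega> in the system [X * X]; the primed copy A' of A has the same basis
   labels as A. *)
Definition max_entangled X : 'cV[R[i]]_#|{: X * X}| :=
  \col_i (((enum_val i).1 == (enum_val i).2)%:R / sqrtC (#|X|%:R)).

Definition choi_adjoint X Y (T : op R Y Y -> op R X X) :
    op R (X * Y)%type (X * Y)%type :=
  #|X|%:R *: id_tens (adjoint T) (max_entangled X *m (max_entangled X) ^t*).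

(** ** Min-entropy *)

Definition log2 (x : R) : R := ln x / ln 2.

Definition elog2 (x : \bar R) : \bar R := (lne x * ((ln 2)^-1)%:E)%E.

(* The inner infimum is +oo when no [lambda] is admissible. *)
Definition Hmin X Y (rho : op R (X * Y)%type (X * Y)%type) : \bar R :=
  (- ereal_inf [set elog2 (ereal_inf
        [set l%:E | l in [set l : R | (0 <= l)%R /\
           psd_le rho (l%:C *: tens (1%:M : op R X X) sigma)]])
      | sigma in [set sigma : op R Y Y | density sigma]])%E.

(** ** Cones and the induced max-divergence *)

Definition convex_cone X (K : set (op R X X)) : Prop :=
  (forall M N, K M -> K N -> K (M + N)) /\
  (forall (t : R) M, 0 <= t -> K M -> K (t%:C *: M)).

Definition cone X (J : set (op R X X)) : set (op R X X) :=
  smallest (@convex_cone X) J.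

Definition real_subspace X (K : set (op R X X)) : Prop :=
  [/\ K 0, (forall M N, K M -> K N -> K (M + N)) &
      (forall (t : R) M, K M -> K (t%:C *: M))].

Definition real_span X (J : set (op R X X)) : set (op R X X) :=
  smallest (@real_subspace X) J.

(* The order <=_S; the order on [R[i]] compares real parts of numbers with
   equal imaginary parts, the traces being real for Hermitian operators. *)
Definition cone_le X (C : set (op R X X)) (M N : op R X X) : Prop :=
  forall F, C F -> \tr (M *m F) <= \tr (N *m F).

Definition cone_Dmax X (C : set (op R X X)) (rho sigma : op R X X) : \bar R :=
  ereal_inf [set l%:E | l in
    [set l : R | cone_le C rho ((2 `^ l)%:C *: sigma)]].

Definition cone_Hmin X Y (C : set (op R (X * Y)%type (X * Y)%type))
    (rho : op R (X * Y)%type (X * Y)%type) : \bar R :=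
  (- ereal_inf [set cone_Dmax C rho (tens (1%:M : op R X X) sigma)
      | sigma in [set sigma : op R Y Y | density sigma]])%E.

End Operators.

(** * Qubit registers and circuits *)

(* Basis labels of the register with one qubit for each element of [W]. *)
Notation bits W := {ffun W -> bool}.

Section Circuits.
Variable R : realType.

Record gate := Gate {
  arity : nat;
  gate_mx : op R (bits 'I_arity) (bits 'I_arity);
  gate_unitary : gate_mx \is unitarymx }.

(* A finite gate set is a family of gates indexed by a finite type. *)
Variables (I : finType) (G : I -> gate).

(* A gate of the set applied to an ordered list of distinct wires of [W]. *)
Record gate_app (W : finType) := GateApp {
  app_gate : I;
  app_wire : 'I_(arity (G app_gate)) -> W;
  app_inj : injective app_wire }.
Arguments app_wire {W} g i : rename.

Definition app_mx (W : finType) (g : gate_app W) : op R (bits W) (bits W) :=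
  mkop (fun y x : bits W =>
    ent (gate_mx (G (app_gate g)))
        [ffun i => y (app_wire g i)] [ffun i => x (app_wire g i)] *
    [forall w, (w \notin codom (app_wire g)) ==> (y w == x w)]%:R).

(* The head of the list is applied first. *)
Definition apps_mx (W : finType) (s : seq (gate_app W)) :
    op R (bits W) (bits W) :=
  foldl (fun U g => app_mx g *m U) 1%:M s.

Definition merge_bits (V W : finType) (v : bits V) (w : bits W) :
    bits (V + W)%type :=
  [ffun z => match z with inl a => v a | inr b => w b end].

(* Circuits H_B (x) H_E -> H_A' (x) H_K, where A' and B are the registers on
   [WA] and [WB], and E and K are ancillary registers.  The bijection
   [output] says which qubit of A' or K each wire ends up as: relabelling
   wires costs no gate. *)
Record circuit (WB WA : finType) := Circuit {
  nE : nat;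
  nK : nat;
  gates : seq (gate_app (WB + 'I_nE)%type);
  output : WB + 'I_nE -> WA + 'I_nK;
  output_bij : bijective output }.
Arguments output {WB WA} c w : rename.

Definition circuit_mx (WB WA : finType) (c : circuit WB WA) :
    op R (bits WB * bits 'I_(nE c))%type (bits WA * bits 'I_(nK c))%type :=
  mkop (fun (y : bits WA * bits 'I_(nK c)) (x : bits WB * bits 'I_(nE c)) =>
    ent (apps_mx (gates c))
        [ffun w => merge_bits y.1 y.2 (output c w)] (merge_bits x.1 x.2)).

(* |0><0| *)
Definition zero_state (W : finType) : op R (bits W) (bits W) :=
  mkop (fun y x : bits W => ((y == [ffun=> false]) && (x == [ffun=> false]))%:R).

Definition circuit_map (WB WA : finType) (c : circuit WB WA)
    (rho : op R (bits WB) (bits WB)) : op R (bits WA) (bits WA) :=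
  ptr_right (circuit_mx c *m tens rho (zero_state 'I_(nE c))
             *m (circuit_mx c) ^t*).

(* The gate complexity C(T); it is +oo if no circuit over [G] implements T. *)
Definition complexity (WB WA : finType)
    (T : op R (bits WB) (bits WB) -> op R (bits WA) (bits WA)) : \bar R :=
  ereal_inf [set (size (gates c))%:R%:E | c in
    [set c : circuit WB WA | forall rho, T rho = circuit_map c rho]].

Definition efficient_choi (bound : R) (WA WB : finType) :
    set (op R (bits WA * bits WB)%type (bits WA * bits WB)%type) :=
  [set choi_adjoint T | T in
    [set T : op R (bits WB) (bits WB) -> op R (bits WA) (bits WA) |
      cptp T /\ (complexity T <= bound%:E)%E]].

Definition efficient_cone (bound : R) (WA WB : finType) :=
  cone (@efficient_choi bound WA WB).

Definition spanning (bound : R) (WA WB : finType) : Prop :=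
  real_span (@efficient_choi bound WA WB) =
  [set M | selfadjoint M /\ exists t : R, ptr_left M = (t%:C)%:M].

Definition comp_Hmin (bound : R) (WA WB : finType)
    (rho : op R (bits WA * bits WB)%type (bits WA * bits WB)%type) : \bar R :=
  cone_Hmin (efficient_cone bound (WA := WA) (WB := WB)) rho.

End Circuits.

(* rho^{(x) k}, as a bipartite operator on A^k and B^k, where the k-fold copy
   of the register on [W] is the register on ['I_k * W]. *)
Definition tens_pow (R : realType) (k : nat) (WA WB : finType)
    (rho : op R (bits WA * bits WB)%type (bits WA * bits WB)%type) :
    op R (bits ('I_k * WA) * bits ('I_k * WB))%type
         (bits ('I_k * WA) * bits ('I_k * WB))%type :=
  mkop (fun y x : bits ('I_k * WA) * bits ('I_k * WB) => \prod_(i < k)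
    ent rho ([ffun w => y.1 (i, w)], [ffun w => y.2 (i, w)])
            ([ffun w => x.1 (i, w)], [ffun w => x.2 (i, w)])).

(** * Asymptotics *)

(* eps(n) = o(n^-c) for every c *)
Definition negl (R : realType) (eps : nat -> R) : Prop :=
  forall c : R, (fun n : nat => eps n * n%:R `^ c) @ \oo --> (0 : R).

Definition poly_bounded (k : nat -> nat) : Prop :=
  exists q : {poly nat}, forall n, (k n <= q.[n])%N.

(* Main.v *)
Require Import Defs.
From mathcomp Require Import all_boot all_order all_algebra.
From mathcomp Require Import complex.
From mathcomp Require Import cyclic separable cyclotomic.
From mathcomp Require Import all_classical all_reals all_analysis.
From mathcomp Require Import zify ring lra.
Import Order.TTheory GRing.Theory Num.Theory.
Import numFieldNormedType.Exports.

Set Implicit Arguments.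
Unset Strict Implicit.
Unset Printing Implicit Defensive.

Local Open Scope sesquilinear_scope.
Local Open Scope ring_scope.

(** Take [rho = (1/M) sum_c |psi_c><psi_c|] with [M = 2^m] and
[psi_c(x, y) = d^-1 w^(s_c(x) + t_c(y)) (-1)^(x.y)], where [w] is a primitive
root of unity of large order and the phases [s], [t] are uniformly random.
Each [psi_c] is exactly maximally entangled because the Hadamard matrix is
unitary; testing [rho^k <= lambda 1 (x) sigma] on [psi_c^k] gives
[lambda >= (d / M)^k], which is the upper bound on the min-entropy.

For an efficient channel with Choi operator [F], the [q]-th moment of
[d^k tr(rho^k F)] over the phases is a first moment over [K = q k] copies.  The
phases kill every matrix element whose row is not a rearrangement of its column
within each colour class [c], so a row-sum bound shows that the moment is at
most [(1 + K^2/M)^K].  Up to idle ancillas, there are at most [2^Q] circuits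
with [Q] polynomial in [n].  Markov's inequality with [q = 2^(m/4)] and a union
bound then give phases for which every efficient channel achieves at most
[d^-k 2^eps], where [eps = (Q + 2 k^3 + 1) / q]. *)

(** * Rearrangements and random phases *)

(* Equals the product of the factorials of the multiplicities. *)
Fixpoint orderings (T : eqType) (s : seq T) : nat :=
  if s is c :: s' then ((count_mem c s').+1 * orderings s')%N else 1%N.

Section BigTuple.
Variables (V : Type) (idx : V) (op : Monoid.com_law idx) (T : finType).

Lemma big_tuple_nil (F : 0.-tuple T -> V) :
  \big[op/idx]_t F t = F [tuple].
Proof. by apply: big_pred1 => t; apply/esym/eqP; exact: tuple0. Qed.

Lemma big_tuple_cons n (F : n.+1.-tuple T -> V) :
  \big[op/idx]_t F t =
  \big[op/idx]_(c : T) \big[op/idx]_(t : n.-tuple T) F [tuple of c :: t].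
Proof.
rewrite pair_bigA /= (reindex (fun p : T * n.-tuple T => [tuple of p.1 :: p.2])) //=.
exists (fun t : n.+1.-tuple T => (thead t, [tuple of behead t])) => [[c t] _|t _] /=.
  by congr pair; apply/val_inj.
by rewrite [RHS]tuple_eta; apply/val_inj.
Qed.

End BigTuple.

Lemma card_fiber_le_count (C X : finType) (c : C) (l : seq (C * X)) :
  (#|[pred x | (c, x) \in l]| <= count_mem c (unzip1 l))%N.
Proof.
rewrite count_map -size_filter -(size_map snd).
apply: leq_trans (card_size _); apply: subset_leq_card; apply/fintype.subsetP => x.
rewrite inE => cxl; apply/mapP; exists (c, x) => //.
by rewrite mem_filter /= eqxx.
Qed.

(** The first partner [x] of [c] must satisfy [(c, x) \in l], which leaves at most as many choices
    as [c] has occurrences in the whole tuple; removing that pair from [l] reduces to the tail.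
    These multiplicities multiply up to [orderings I]. *)
Lemma card_perm_zip_le (C X : finType) n (I : n.-tuple C) (l : seq (C * X)) :
  perm_eq (unzip1 l) I ->
  (\sum_(x : n.-tuple X) perm_eq (zip I x) l <= orderings I)%N.
Proof.
elim: n I l => [|n IHn] I l.
  by move=> _; rewrite big_tuple_nil (tuple0 I) /=; case: (perm_eq _ _).
case/tupleP: I => c I /= lI.
rewrite big_tuple_cons /=.
apply: (@leq_trans (\sum_(x | (c, x) \in l) orderings I)%N); last first.
  rewrite sum_nat_const leq_mul2r; apply/orP; right.
  apply: leq_trans (card_fiber_le_count c l) _.
  by move/permP: lI => /(_ (pred1 c)) ->; rewrite /= eqxx.
rewrite (bigID (fun x => (c, x) \in l)) /= addnC big1 ?add0n => [|x /negPf cxl].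
  apply: leq_sum => x cxl.
  have lE := perm_to_rem cxl.
  rewrite (eq_bigr (fun t : n.-tuple X => nat_of_bool (perm_eq (zip I t) (rem (c, x) l)))).
    apply: IHn.
    have := perm_map fst lE; rewrite perm_sym /= -/unzip1 => h.
    by rewrite -(perm_cons c); apply: perm_trans h _.
  by move=> t _; rewrite (permPr lE) perm_cons.
rewrite big1 // => t _; apply/eqP; rewrite eqb0; apply/negP => /perm_mem/(_ (c, x)).
by rewrite cxl inE eqxx.
Qed.

Lemma leq_exp2rW m n e : (m <= n)%N -> (m ^ e <= n ^ e)%N.
Proof. by case: e => // e; rewrite leq_exp2r. Qed.

Lemma sum_count_mem (C : finType) (s : seq C) :
  (\sum_(c : C) count_mem c s = size s)%N.
Proof.
elim: s => [|a s IHs] /=; first by rewrite big1.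
rewrite big_split /= IHs (bigD1 a) //= eqxx big1 ?addn0 // => c ca.
by rewrite eq_sym (negPf ca).
Qed.

Lemma sum_count_sqr_le (C : finType) (s : seq C) :
  (\sum_(c : C) (count_mem c s).+1 ^ 2 <= #|C| + (size s).+1 ^ 2)%N.
Proof.
have -> : (\sum_(c : C) (count_mem c s).+1 ^ 2 =
  \sum_(c : C) (1 + (count_mem c s * 2 + count_mem c s * count_mem c s)))%N.
  by apply: eq_bigr => c _; rewrite -mulnn; lia.
rewrite !big_split /= sum1_card leq_add2l -big_distrl /= sum_count_mem.
have : (\sum_(c : C) count_mem c s * count_mem c s <= size s * size s)%N.
  rewrite -{2}(sum_count_mem s) big_distrr /=; apply: leq_sum => c _.
  by rewrite leq_mul2r count_size orbT.
move: (\sum_(c : C) count_mem c s * count_mem c s)%N => b.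
by rewrite -mulnn; nia.
Qed.

(** Prepending a colour [c] multiplies [orderings] by the count of [c] plus one, so each position
    contributes a factor bounded by [sum_count_sqr_le]. The length bound [N] stays fixed in the
    induction so that all factors agree. *)
Lemma sum_orderings_sqr_le (C : finType) n N : (n <= N)%N ->
  (\sum_(I : n.-tuple C) orderings I ^ 2 <= (#|C| + N ^ 2) ^ n)%N.
Proof.
elim: n => [|n IHn] nN.
  by rewrite big_tuple_nil.
rewrite big_tuple_cons /= exchange_big /= expnS mulnC.
apply: leq_trans (leq_mul (IHn (ltnW nN)) (leqnn _)).
rewrite big_distrl /=; apply: leq_sum => I _.
under eq_bigr do rewrite expnMn.
rewrite -big_distrl /= mulnC leq_mul2l; apply/orP; right.
apply: leq_trans (sum_count_sqr_le _) _.
by rewrite leq_add2l leq_exp2r // size_tuple.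
Qed.

Lemma prod_count_mem (C : comNzRingType) (E : finType) (f : E -> C) (l : seq E) :
  \prod_(e <- l) f e = \prod_(e : E) f e ^+ count_mem e l.
Proof.
elim: l => [|a l IHl]; first by rewrite big_nil big1.
rewrite big_cons IHl [RHS](bigD1 a) //= eqxx exprS -mulrA; congr (_ * _).
rewrite [LHS](bigD1 a) //=; congr (_ * _); apply: eq_bigr => e ea.
by rewrite eq_sym (negPf ea).
Qed.

Lemma norm_prim_root (C : numClosedFieldType) r (w : C) :
  (0 < r)%N -> r.-primitive_root w -> `|w| = 1.
Proof.
move=> r0 wr; apply/eqP; rewrite -(pexpr_eq1 r0) ?normr_ge0 // -normrX.
by rewrite (prim_expr_order wr) normr1.
Qed.

(** Conjugation inverts [w], so the sum is geometric with ratio [w^(a-b)]; as [a, b < r], this ratio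
    is 1 only for [a = b]. *)
Lemma sum_prim_root_exp (C : numClosedFieldType) r (w : C) (a b : nat) :
  r.-primitive_root w -> (a < r)%N -> (b < r)%N ->
  \sum_(u < r) (w ^+ u) ^+ a * ((w ^+ u) ^+ b)^* = r%:R * (a == b)%:R.
Proof.
move=> wr ar br.
have r0 : (0 < r)%N by apply: leq_ltn_trans ar.
have w1 := norm_prim_root r0 wr.
have w0 : w != 0 by rewrite -normr_eq0 w1 oner_eq0.
have wV : w^* = w^-1.
  apply: (mulfI w0); rewrite -normCK w1 expr1n divff //.
pose z := w ^+ a / w ^+ b.
have -> : \sum_(u < r) (w ^+ u) ^+ a * ((w ^+ u) ^+ b)^* = \sum_(u < r) z ^+ u.
  apply: eq_bigr => u _; rewrite !rmorphXn /= wV /z expr_div_n.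
  by rewrite exprVn exprVn -!exprM mulnC [(b * u)%N]mulnC.
have zr : z ^+ r = 1.
  rewrite expr_div_n -!exprM ![(_ * r)%N]mulnC !exprM (prim_expr_order wr).
  by rewrite !expr1n divff ?oner_eq0.
case: (eqVneq a b) => [ab|ab].
  rewrite /z ab divff ?expf_neq0 //.
  by under eq_bigr do rewrite expr1n; rewrite sumr_const card_ord mulr1.
have z1 : z - 1 != 0.
  rewrite subr_eq0; apply: contra ab => /eqP z1.
  have /eqP : w ^+ a = w ^+ b.
    by rewrite -[LHS](divfK (expf_neq0 b w0)) -/z z1 mul1r.
  by rewrite (eq_prim_root_expr wr) !modn_small.
by apply: (mulfI z1); rewrite -subrX1 zr subrr mulr0 mulr0.
Qed.

(** The phases of distinct elements are independent, so the sum factors over [E], and each factor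
    compares two multiplicities. Lists shorter than [r] keep the exponents from wrapping around. *)
Lemma phase_mean (C : numClosedFieldType) (E : finType) r (w : C) (l l' : seq E) :
  r.-primitive_root w -> (size l < r)%N -> (size l' < r)%N ->
  \sum_(s : {ffun E -> 'I_r})
     (\prod_(e <- l) w ^+ s e) * (\prod_(e <- l') w ^+ s e)^* =
  #|{ffun E -> 'I_r}|%:R * (perm_eq l l')%:R.
Proof.
move=> wr lr lr'.
have cl (s : seq E) e : (size s < r)%N -> (count_mem e s < r)%N.
  by move=> sr; apply: leq_ltn_trans (count_size _ _) sr.
under eq_bigr => s _.
  rewrite (prod_count_mem (fun e => w ^+ s e)).
  rewrite (prod_count_mem (fun e => w ^+ s e)) rmorph_prod -big_split /=.
  over.
rewrite -(bigA_distr_bigA (fun e (u : 'I_r) =>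
  (w ^+ u) ^+ count_mem e l * ((w ^+ u) ^+ count_mem e l')^*)) /=.
under eq_bigr do rewrite (sum_prim_root_exp wr (cl _ _ lr) (cl _ _ lr')).
rewrite big_split /= prodr_const card_ffun card_ord natrX; congr (_ * _).
case: (boolP (perm_eq l l')) => [/permP h|h].
  by rewrite big1 // => e _; rewrite (h (pred1 e)) eqxx.
have /existsP[e /negPf he] : [exists e, count_mem e l != count_mem e l'].
  apply: contraR h; rewrite negb_exists => /forallP h.
  by apply/allP => e _; have := h e; rewrite negbK.
by rewrite (bigD1 e) //= he mul0r.
Qed.

(** * Moments of the overlap with a Gram matrix *)

Section Moments.
Variables (C : numClosedFieldType) (X Y : finType) (chi : X -> Y -> C).
Hypothesis chi_unit : forall x y, `|chi x y| = 1.
Variables (M r : nat) (w : C).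
Hypothesis wr : r.-primitive_root w.

Definition phases := ({ffun 'I_M * X -> 'I_r} * {ffun 'I_M * Y -> 'I_r})%type.

Definition amp (s : phases) (c : 'I_M) (x : X) (y : Y) : C :=
  w ^+ s.1 (c, x) * w ^+ s.2 (c, y) * chi x y.

(* Only the rearrangements within each colour class survive the average over
   the phases. *)
Lemma mean_amp (P : finType) (i : P -> 'I_M) (x x' : P -> X) (y y' : P -> Y) :
  (#|P| < r)%N ->
  `|\sum_(s : phases) \prod_p (amp s (i p) (x p) (y p) *
                              (amp s (i p) (x' p) (y' p))^*)| =
  #|{: phases}|%:R *
   (perm_eq [seq (i p, x p) | p <- enum P] [seq (i p, x' p) | p <- enum P] &&
    perm_eq [seq (i p, y p) | p <- enum P] [seq (i p, y' p) | p <- enum P])%:R.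
Proof.
move=> Pr.
pose f (T : finType) (s : {ffun 'I_M * T -> 'I_r}) (z : P -> T) : C :=
  \prod_(e <- [seq (i p, z p) | p <- enum P]) w ^+ s e.
have -> : \sum_(s : phases) \prod_p (amp s (i p) (x p) (y p) *
                              (amp s (i p) (x' p) (y' p))^*) =
  (\sum_(s : {ffun 'I_M * X -> 'I_r}) f X s x * (f X s x')^*) *
  (\sum_(s : {ffun 'I_M * Y -> 'I_r}) f Y s y * (f Y s y')^*) *
  \prod_p (chi (x p) (y p) * (chi (x' p) (y' p))^*).
  rewrite big_distrlr /= pair_bigA /= big_distrl /=; apply: eq_bigr => s _.
  rewrite /f !big_map !rmorph_prod -!big_enum /= -!big_split /=.
  by apply: eq_bigr => p _; rewrite /amp !rmorphM /=; ring.
have sz (T : finType) (z : P -> T) : (size [seq (i p, z p) | p <- enum P] < r)%N.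
  by rewrite size_map -cardE.
rewrite !(phase_mean wr) ?sz // normrM normr_prod.
rewrite [X in _ * X]big1 => [|p _]; last by rewrite normrM norm_conjC !chi_unit mulr1.
rewrite mulr1 !normrM !normr_nat mulrACA -!natrM card_prod.
by case: (perm_eq _ _); case: (perm_eq _ _).
Qed.

(** The two conditions are counted separately, each by [card_perm_zip_le]; joint injectivity of [px]
    and [py] makes [b'] recoverable from its two label tuples. *)
Lemma card_rearrangements_le (P B : finType) (px : B -> P -> X) (py : B -> P -> Y)
    (i : P -> 'I_M) (b : B) :
  (forall b1 b2, px b1 =1 px b2 -> py b1 =1 py b2 -> b1 = b2) ->
  (\sum_(b' : B)
   (perm_eq [seq (i p, px b' p) | p <- enum P] [seq (i p, px b p) | p <- enum P] &&
    perm_eq [seq (i p, py b' p) | p <- enum P] [seq (i p, py b p) | p <- enum P])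
   <= orderings [seq i p | p <- enum P] ^ 2)%N.
Proof.
move=> inj.
have szP (T : Type) (f : P -> T) : size [seq f p | p <- enum P] == #|P|.
  by rewrite size_map -cardE.
pose tx (f : B -> P -> X) b' : #|P|.-tuple X := Tuple (szP _ (f b')).
pose ty (f : B -> P -> Y) b' : #|P|.-tuple Y := Tuple (szP _ (f b')).
have zipE (T : finType) (f : P -> T) :
    [seq (i p, f p) | p <- enum P] = zip [seq i p | p <- enum P] [seq f p | p <- enum P].
  by elim: (enum P) => //= a s ->.
pose ti := Tuple (szP _ i).
have lI (T : finType) (f : P -> T) : perm_eq (unzip1 [seq (i p, f p) | p <- enum P]) ti.
  by rewrite /unzip1 -map_comp; exact: perm_refl.
have hx := card_perm_zip_le (lI X (px b)); have hy := card_perm_zip_le (lI Y (py b)).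
rewrite -mulnn; apply: leq_trans (leq_mul hx hy).
rewrite big_distrlr /= pair_bigA /=.
pose g b' := (tx px b', ty py b').
have gI : injective g.
  move=> b1 b2 [/eq_in_map h1 /eq_in_map h2]; apply: inj => p.
    by apply: h1; rewrite mem_enum.
  by apply: h2; rewrite mem_enum.
rewrite (partition_big g xpredT) //=; apply: leq_sum => -[u v] _.
pose Q := (perm_eq (zip ti u) [seq (i p, px b p) | p <- enum P] *
           perm_eq (zip ti v) [seq (i p, py b p) | p <- enum P])%N.
apply: (@leq_trans (\sum_(b' | g b' == (u, v)) Q)%N).
  apply: leq_sum => b' /eqP; rewrite /Q => -[<- <-] /=; rewrite -!zipE.
  by case: (perm_eq _ _); case: (perm_eq _ _).
rewrite sum_nat_const -[X in (_ <= X)%N]mul1n leq_mul2r; apply/orP; right.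
apply/card_le1_eqP => b1 b2; rewrite !unfold_in => e1 e2; apply: gI.
by rewrite (eqP (e1 : g b1 == (u, v))) (eqP (e2 : g b2 == (u, v))).
Qed.


Section Power.
Variables (A B K : finType) (px : B -> A -> X) (py : B -> A -> Y).
Hypothesis p_inj : forall b1 b2, px b1 =1 px b2 -> py b1 =1 py b2 -> b1 = b2.

(** Up to normalisation, an entry of the tensor power of [sum_c |psi_c><psi_c|], with [A] indexing
    the copies. *)
Definition copies (s : phases) (b b' : B) : C :=
  \prod_a \sum_c amp s c (px b a) (py b a) * (amp s c (px b' a) (py b' a))^*.

Variable V : K -> B -> C.

Definition gram (b b' : B) : C := \sum_k V k b * (V k b')^*.

Definition overlap (s : phases) : C :=
  \sum_b \sum_b' copies s b b' * gram b' b.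

Variable q : nat.
(** A [q]-th moment for [#|A|] copies is a first moment for the copies indexed by [P]. *)
Let P : finType := ('I_q * A)%type.
Let x (z : {ffun 'I_q -> B}) (p : P) := px (z p.1) p.2.
Let y (z : {ffun 'I_q -> B}) (p : P) := py (z p.1) p.2.

Let xy_inj z1 z2 : x z1 =1 x z2 -> y z1 =1 y z2 -> z1 = z2.
Proof.
move=> hx hy; apply/ffunP => t; apply: p_inj => a.
  by have := hx (t, a).
by have := hy (t, a).
Qed.

Lemma overlap_exp s :
  overlap s ^+ q = \sum_z \sum_z' \sum_(i : {ffun P -> 'I_M})
    (\prod_p (amp s (i p) (x z p) (y z p) * (amp s (i p) (x z' p) (y z' p))^*)) *
    \prod_t gram (z' t) (z t).
Proof.
rewrite -[in LHS](card_ord q) -prodr_const /overlap bigA_distr_bigA /=.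
apply: eq_bigr => z _; rewrite bigA_distr_bigA /=; apply: eq_bigr => z' _.
rewrite big_split /= -big_distrl /=; congr (_ * _).
rewrite -(bigA_distr_bigA (fun p c => amp s c (x z p) (y z p) * (amp s c (x z' p) (y z' p))^*)) /=.
by rewrite /copies pair_bigA.
Qed.

Let v (k : {ffun 'I_q -> K}) (z : {ffun 'I_q -> B}) := \prod_t V (k t) (z t).
Let D (z : {ffun 'I_q -> B}) := \prod_t gram (z t) (z t).

Let D_sum z : D z = \sum_k `|v k z| ^+ 2.
Proof.
rewrite /D /gram bigA_distr_bigA /=; apply: eq_bigr => k _.
rewrite normCK rmorph_prod -big_split /=.
by [].
Qed.

(** [2 u v <= u^2 + v^2], summed over the product vectors [v k], bounds an off-diagonal entry of a
    positive matrix by the mean of two diagonal ones. *)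
Let prod_gram_le (z z' : {ffun 'I_q -> B}) : `|\prod_t gram (z' t) (z t)| <= (D z + D z') / 2.
Proof.
rewrite /gram bigA_distr_bigA /= !D_sum -big_split /= big_distrl /=.
apply: le_trans (ler_norm_sum _ _ _) _; apply: ler_sum => k _.
have -> : \prod_t (V (k t) (z' t) * (V (k t) (z t))^*) = v k z' * (v k z)^*.
  by rewrite big_split /= rmorph_prod.
rewrite normrM norm_conjC ler_pdivlMr ?ltr0n // -subr_ge0.
have -> : `|v k z| ^+ 2 + `|v k z'| ^+ 2 - `|v k z'| * `|v k z| * 2 =
   (`|v k z| - `|v k z'|) ^+ 2 by ring.
by rewrite real_exprn_even_ge0 // realB ?normr_real.
Qed.

(** The number of colourings of the copies for which the matrix element between [z] and [z']
    survives the phase average. *)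
Let R z z' : nat := \sum_(i : {ffun P -> 'I_M})
   (perm_eq [seq (i p, x z p) | p <- enum P] [seq (i p, x z' p) | p <- enum P] &&
    perm_eq [seq (i p, y z p) | p <- enum P] [seq (i p, y z' p) | p <- enum P]).

Let R_sym z z' : R z z' = R z' z.
Proof.
by rewrite /R; apply: eq_bigr => i _; rewrite ![perm_eq [seq (_, _ z _) | _ <- _] _]perm_sym.
Qed.

(** After exchanging the sums, a fixed colouring contributes at most [orderings ^ 2], one factor for
    each of the two registers; the colourings are then summed by [sum_orderings_sqr_le]. *)
Let R_sum z : (\sum_z' R z z' <= (M + (q * #|A|) ^ 2) ^ (q * #|A|))%N.
Proof.
under eq_bigr do rewrite R_sym.
rewrite exchange_big /=.
apply: (@leq_trans (\sum_(i : {ffun P -> 'I_M}) orderings [seq i p | p <- enum P] ^ 2)%N).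
  by apply: leq_sum => i _; exact: (card_rearrangements_le i z xy_inj).
have cP : #|P| = (q * #|A|)%N by rewrite card_prod card_ord.
rewrite -cP; have := sum_orderings_sqr_le 'I_M (leqnn #|P|); rewrite card_ord.
apply: leq_trans.
have szP (f : P -> 'I_M) : size [seq f p | p <- enum P] == #|P|.
  by rewrite size_map -cardE.
rewrite [X in (_ <= X)%N](reindex (fun i : {ffun P -> 'I_M} => Tuple (szP i))) //=.
exists (fun t : #|P|.-tuple 'I_M => [ffun p => tnth t (enum_rank p)]) => [i _|t _].
  apply/ffunP => p; rewrite ffunE (tnth_nth (i p)) /= (nth_map p) -?cardE //.
  by rewrite nth_enum_rank.
apply: eq_from_tnth => j; rewrite (tnth_nth (tnth t j)) /= (nth_map (enum_val j)) -?cardE //.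
by rewrite ffunE -enum_val_nth enum_valK.
Qed.

(** A Schur test: phase averaging leaves the nonnegative symmetric weights [R], the Gram entries are
    at most means of diagonal ones, and the row sums of [R] are bounded uniformly. *)
Lemma overlap_moment : (q * #|A| < r)%N ->
  `|\sum_s overlap s ^+ q| <=
  #|{: phases}|%:R * ((M + (q * #|A|) ^ 2) ^ (q * #|A|))%:R *
  (\sum_b gram b b) ^+ q.
Proof.
move=> qr; have Pr : (#|P| < r)%N by rewrite card_prod card_ord.
under eq_bigr do rewrite overlap_exp.
rewrite exchange_big /=.
have D0 z : 0 <= D z by rewrite D_sum sumr_ge0 // => k _; rewrite exprn_ge0.
apply: (@le_trans _ _ (\sum_z \sum_z' #|{: phases}|%:R * (R z z')%:R * ((D z + D z') / 2))).
  apply: le_trans (ler_norm_sum _ _ _) _; apply: ler_sum => z _.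
  rewrite exchange_big /=.
  apply: le_trans (ler_norm_sum _ _ _) _; apply: ler_sum => z' _.
  rewrite exchange_big /=.
  under eq_bigr do rewrite -big_distrl /=.
  rewrite -big_distrl /= normrM ler_pM ?normr_ge0 ?prod_gram_le //.
  rewrite /R natr_sum big_distrr /=.
  apply: le_trans (ler_norm_sum _ _ _) _; apply: ler_sum => i _.
  by rewrite (mean_amp i (x z) (x z') (y z) (y z') Pr).
have -> : \sum_z \sum_z' #|{: phases}|%:R * (R z z')%:R * ((D z + D z') / 2) =
   #|{: phases}|%:R * \sum_z (\sum_z' R z z')%:R * D z.
  (* Since [R] is symmetric, the two halves [D z] and [D z'] contribute the same sum [S]. *)
  pose S := \sum_z \sum_z' (R z z')%:R * D z.
  have S' : S = \sum_z \sum_z' (R z z')%:R * D z'.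
    rewrite /S exchange_big /=; apply: eq_bigr => z _; apply: eq_bigr => z' _.
    by rewrite R_sym.
  have -> : \sum_z (\sum_z' R z z')%:R * D z = (S + S) / 2.
    have -> : (S + S) / 2 = S by field.
    by apply: eq_bigr => z _; rewrite natr_sum big_distrl.
  rewrite {2}S' /S -big_split /= mulrA big_distrr /= big_distrl /=.
  apply: eq_bigr => z _; rewrite -big_split /= big_distrr big_distrl /=.
  by apply: eq_bigr => z' _; field.
rewrite -mulrA ler_wpM2l ?ler0n //.
have -> : (\sum_b gram b b) ^+ q = \sum_z D z.
  rewrite -[in LHS](card_ord q) -prodr_const bigA_distr_bigA /=.
  by [].
rewrite big_distrr /=; apply: ler_sum => z _.
by rewrite ler_wpM2r // ler_nat R_sum.
Qed.

End Power.
End Moments.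

(** Separability gives [X^n - 1] distinct roots, and [n] distinct [n]-th roots of unity include a
    primitive one. *)
Lemma prim_root_exists (C : numClosedFieldType) n :
  (0 < n)%N -> exists z : C, n.-primitive_root z.
Proof.
move=> n0; have [s Dp] := closed_field_poly_normal ('X^n - 1 : {poly C}).
rewrite (monicP _) ?monicXnsubC // scale1r in Dp.
have s1 : all n.-unity_root s by apply/allP=> z; rewrite -root_prod_XsubC -Dp.
have sz : (n < (size s).+1)%N by rewrite -(size_prod_XsubC s id) -Dp size_XnsubC.
have [|z _ zn] := hasP (has_prim_root n0 s1 _ sz); last by exists z.
by rewrite -separable_prod_XsubC -Dp separable_Xn_sub_1 // pnatr_eq0 -lt0n.
Qed.

(** * Markov's inequality and the union bound *)

Section Union.
Variables (C : numClosedFieldType) (X Y : finType) (chi : X -> Y -> C).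
Hypothesis chi_unit : forall x y, `|chi x y| = 1.
Variables (M r : nat) (w : C).
Hypothesis wr : r.-primitive_root w.
Variables (A B : finType) (px : B -> A -> X) (py : B -> A -> Y).
Hypothesis p_inj : forall b1 b2, px b1 =1 px b2 -> py b1 =1 py b2 -> b1 = b2.

Lemma copies_sum (s : phases X Y M r) b b' :
  copies chi w px py s b b' = \sum_(i : {ffun A -> 'I_M})
    (\prod_a amp chi w s (i a) (px b a) (py b a)) *
    (\prod_a amp chi w s (i a) (px b' a) (py b' a))^*.
Proof.
rewrite /copies bigA_distr_bigA /=; apply: eq_bigr => i _.
by rewrite rmorph_prod -big_split.
Qed.

(** The trace of a product of two positive matrices is a sum of squared moduli; Markov's inequality
    needs this sign. *)
Lemma overlap_ge0 (K : finType) (V : K -> B -> C) (s : phases X Y M r) :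
  0 <= overlap chi w px py V s.
Proof.
have -> : overlap chi w px py V s = \sum_(i : {ffun A -> 'I_M}) \sum_k
  `|\sum_b (\prod_a amp chi w s (i a) (px b a) (py b a)) * (V k b)^*| ^+ 2.
  rewrite /overlap; under eq_bigr => b _ do under eq_bigr => b' _ do
    rewrite copies_sum big_distrl /=.
  under eq_bigr do rewrite exchange_big /=.
  rewrite exchange_big /=; apply: eq_bigr => i _.
  under eq_bigr => b _ do under eq_bigr => b' _ do rewrite /gram big_distrr /=.
  under eq_bigr do rewrite exchange_big /=.
  rewrite exchange_big /=; apply: eq_bigr => k _.
  rewrite normCK rmorph_sum big_distrlr /=; apply: eq_bigr => b _.
  apply: eq_bigr => b' _; rewrite rmorphM /= conjCK; ring.
by apply: sumr_ge0 => i _; apply: sumr_ge0 => k _; rewrite exprn_ge0.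
Qed.

(** Markov's inequality with a union bound, read contrapositively: if every choice of phases had a
    good [j] with overlap above [beta], the [q]-th powers summed over good [j] would reach [beta^q]
    for each choice, against [overlap_moment]. *)
Lemma good_phases (T : finType) (good : pred T) (F : T -> B -> B -> C) (t beta : C) q :
  (forall j, good j -> exists (K : finType) (V : K -> B -> C),
     forall b b', F j b b' = gram V b b') ->
  (forall j, good j -> \sum_b F j b b = t) ->
  0 <= t -> 0 <= beta -> (q * #|A| < r)%N ->
  #|T|%:R * (((M + (q * #|A|) ^ 2) ^ (q * #|A|))%:R * t ^+ q) < beta ^+ q ->
  exists s : phases X Y M r, forall j, good j ->
    \sum_b \sum_b' copies chi w px py s b b' * F j b' b <= beta.
Proof.
move=> FV Ft t0 b0 qr small.
pose ov (s : phases X Y M r) j := \sum_b \sum_b' copies chi w px py s b b' * F j b' b.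
have ovE s j (K : finType) (V : K -> B -> C) :
    (forall b b', F j b b' = gram V b b') -> ov s j = overlap chi w px py V s.
  move=> e; apply: eq_bigr => b _; apply: eq_bigr => b' _; by rewrite e.
suff /existsP[s /forallP h] : [exists s, forall j, good j ==> (ov s j <= beta)].
  by exists s => j /(implyP (h j)).
apply: contraLR small; rewrite negb_exists => /forallP bad.
have ov0 s j : good j -> 0 <= ov s j.
  by move=> /FV[K [V /ovE ->]]; apply: overlap_ge0.
have r0 : (0 < r)%N by apply: leq_ltn_trans qr.
have N0 : 0 < #|{: phases X Y M r}|%:R :> C.
  by rewrite ltr0n card_prod !card_ffun !card_ord muln_gt0 !expn_gt0 r0.
set W := _%:R * t ^+ q.
have lb : #|{: phases X Y M r}|%:R * beta ^+ q <= \sum_s \sum_(j | good j) ov s j ^+ q.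
  rewrite mulr_natl -sumr_const; apply: ler_sum => s _.
  have /existsP[j] : [exists j, ~~ (good j ==> (ov s j <= beta))].
    by have := bad s; rewrite negb_forall.
  rewrite negb_imply => /andP[gj]; rewrite -real_ltNge ?ger0_real ?ov0 // => h.
  rewrite (bigD1 j) //= -[X in X <= _]addr0 lerD //.
    by apply: lerXn2r; rewrite ?nnegrE ?ov0 // ltW.
  by apply: sumr_ge0 => i /andP[gi _]; rewrite exprn_ge0 ?ov0.
have ub : \sum_s \sum_(j | good j) ov s j ^+ q <=
          #|{: phases X Y M r}|%:R * (#|T|%:R * W).
  rewrite exchange_big /=.
  apply: (@le_trans _ _ (\sum_(j | good j) #|{: phases X Y M r}|%:R * W)).
    apply: ler_sum => j gj; have [K [V e]] := FV j gj.
    have e2 : \sum_s ov s j ^+ q =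
        \sum_(s : phases X Y M r) overlap chi w px py V s ^+ q.
      by apply: eq_bigr => s _; rewrite (ovE _ _ _ _ e).
    rewrite e2 -[leLHS]ger0_norm; last first.
      by apply: sumr_ge0 => s _; rewrite exprn_ge0 ?overlap_ge0.
    apply: le_trans (overlap_moment chi_unit M wr p_inj V qr) _.
    have -> : \sum_b gram V b b = t.
      by rewrite -(Ft j gj); apply: eq_bigr => b _; rewrite e.
    by rewrite /W mulrA.
  rewrite sumr_const -[_ *+ _]mulr_natl mulrCA; apply: ler_wpM2l; first exact: ler0n.
  apply: ler_wpM2r; first by rewrite mulr_ge0 ?ler0n ?exprn_ge0.
  by rewrite ler_nat max_card.
rewrite -real_leNgt ?ger0_real ?exprn_ge0 // ?mulr_ge0 ?ler0n ?exprn_ge0 //.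
by rewrite -(ler_pM2l N0) (le_trans lb).
Qed.

End Union.

(** * Matrix entries and Choi operators *)

Lemma sum_pair (V : nmodType) (X Y : finType) (F : X * Y -> V) :
  \sum_z F z = \sum_x \sum_y F (x, y).
Proof. by rewrite pair_bigA; apply: eq_bigr => -[]. Qed.

Section Entries.
Variable R : realType.
Implicit Types X Y Z : finType.

Lemma ent_mkop X Y (F : Y -> X -> R[i]) y x : ent (mkop F) y x = F y x.
Proof. by rewrite /ent /mkop mxE !enum_rankK. Qed.

Lemma op_ext X Y (M N : op R X Y) : (forall y x, ent M y x = ent N y x) -> M = N.
Proof.
move=> h; apply/matrixP => i j.
by have := h (enum_val i) (enum_val j); rewrite /ent !enum_valK.
Qed.

Lemma sum_enum_rank X (F : 'I_#|X| -> R[i]) : \sum_i F i = \sum_x F (enum_rank x).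
Proof.
rewrite (reindex (@enum_rank X)) //.
by exists enum_val => ? _; rewrite ?enum_rankK ?enum_valK.
Qed.

Lemma ent_tens X1 Y1 X2 Y2 (M : op R X1 Y1) (N : op R X2 Y2) y x :
  ent (tens M N) y x = ent M y.1 x.1 * ent N y.2 x.2.
Proof. exact: ent_mkop. Qed.

Lemma ent_mulmx X Y Z (M : op R Y Z) (N : op R X Y) z x :
  ent (M *m N) z x = \sum_y ent M z y * ent N y x.
Proof. by rewrite /ent mxE sum_enum_rank. Qed.

Lemma ent_adjmx X Y (M : op R X Y) x y : ent (M ^t* : op R Y X) x y = (ent M y x)^*.
Proof. by rewrite /ent !mxE. Qed.

Lemma ent_scale X Y c (M : op R X Y) y x : ent (c *: M) y x = c * ent M y x.
Proof. by rewrite /ent mxE. Qed.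

Lemma ent_add X Y (M N : op R X Y) y x : ent (M + N) y x = ent M y x + ent N y x.
Proof. by rewrite /ent mxE. Qed.

Lemma ent_opp X Y (M : op R X Y) y x : ent (- M) y x = - ent M y x.
Proof. by rewrite /ent mxE. Qed.

Lemma ent_scalar X (c : R[i]) (x y : X) : ent (c%:M : op R X X) x y = c *+ (x == y).
Proof. by rewrite /ent mxE (inj_eq enum_rank_inj). Qed.

Lemma ent_delta X (a b x y : X) :
  ent (delta_mx (enum_rank a) (enum_rank b) : op R X X) x y = ((x == a) && (y == b))%:R.
Proof. by rewrite /ent mxE !(inj_eq enum_rank_inj). Qed.

Lemma trace_ent X (M : op R X X) : \tr M = \sum_x ent M x x.
Proof. by rewrite /mxtrace sum_enum_rank. Qed.

Definition ket X (f : X -> R[i]) : 'cV[R[i]]_#|X| := \col_i f (enum_val i).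

Lemma expectation_ent X (M : op R X X) (v : 'cV[R[i]]_#|X|) :
  (v ^t* *m M *m v) 0 0 =
  \sum_x \sum_y (v (enum_rank x) 0)^* * ent M x y * v (enum_rank y) 0.
Proof.
rewrite mxE sum_enum_rank exchange_big /=; apply: eq_bigr => y _.
rewrite mxE sum_enum_rank big_distrl /=; apply: eq_bigr => x _.
by rewrite !mxE.
Qed.

Lemma psd_gram X (K : finType) (V : K -> X -> R[i]) : psd (mkop (gram V) : op R X X).
Proof.
split.
  apply: op_ext => x y; rewrite ent_adjmx !ent_mkop /gram rmorph_sum.
  by apply: eq_bigr => k _; rewrite rmorphM /= conjCK mulrC.
move=> v; rewrite expectation_ent.
have -> : \sum_x \sum_y (v (enum_rank x) 0)^* *
    ent (mkop (gram V) : op R X X) x y * v (enum_rank y) 0 =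
   \sum_k `|\sum_x (v (enum_rank x) 0)^* * V k x| ^+ 2.
  under [RHS]eq_bigr do rewrite normCK rmorph_sum big_distrlr /=.
  rewrite [RHS]exchange_big /=; apply: eq_bigr => x _.
  rewrite [RHS]exchange_big /=; apply: eq_bigr => y _.
  rewrite ent_mkop /gram big_distrr big_distrl /=; apply: eq_bigr => k _.
  by rewrite rmorphM /= conjCK; ring.
by apply: sumr_ge0 => k _; rewrite exprn_ge0.
Qed.

(** The two factors [1/sqrt d] of [|Omega>] cancel the dimension, and the conjugate comes from
    taking the adjoint of [T]. *)
Lemma ent_choi X Y (T : op R Y Y -> op R X X) (a a' : X) (b b' : Y) :
  ent (choi_adjoint T) (a, b) (a', b') =
  (ent (T (delta_mx (enum_rank b) (enum_rank b'))) a a')^*.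
Proof.
rewrite /choi_adjoint ent_scale ent_mkop /=.
have [X0|X0] := posnP #|X|; first by have := max_card (pred1 a); rewrite card1 X0.
have XC : #|X|%:R != 0 :> R[i] by rewrite pnatr_eq0 -lt0n.
rewrite {1}/ent /adjoint mxE trace_ent.
under eq_bigr do rewrite ent_mulmx.
rewrite exchange_big /= (bigD1 a) //= (bigD1 a') //=.
rewrite !big1 ?addr0.
- rewrite ent_adjmx ent_mkop /ent !mxE big_ord1 !mxE !enum_rankK /= !eqxx !mul1r.
  have -> : ((sqrtC #|X|%:R)^-1 : R[i])^* = (sqrtC #|X|%:R)^-1.
    by apply: conj_Creal; rewrite realV ger0_real // sqrtC_ge0 ler0n.
  by rewrite -invfM -expr2 sqrtCK mulrCA divff // mulr1.
- move=> x xa; rewrite big1 // => y _; rewrite ent_mkop /ent !mxE big_ord1 !mxE.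
  by rewrite !enum_rankK /= eq_sym (negPf xa) mul0r mul0r mulr0.
move=> y ya; rewrite ent_mkop /ent !mxE big_ord1 !mxE.
by rewrite !enum_rankK /= [a' == y]eq_sym (negPf ya) mul0r conjC0 !mulr0.
Qed.

Lemma choi_trace X Y (T : op R Y Y -> op R X X) (b b' : Y) :
  (forall M, \tr (T M) = \tr M) ->
  \sum_(a : X) ent (choi_adjoint T) (a, b) (a, b') = (b == b')%:R.
Proof.
move=> tp; under eq_bigr do rewrite ent_choi.
rewrite -rmorph_sum -trace_ent tp trace_ent (bigD1 b) //= big1 ?addr0 => [|x xb].
  by rewrite ent_delta eqxx conjC_nat.
by rewrite ent_delta (negPf xb).
Qed.

(** Trace preservation makes the partial trace of the Choi operator over [X] the identity, so
    [1 (x) sigma] has the same test value for every channel. The max-divergence thus reduces to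
    bounding traces against [rho]. *)
Lemma trace_tens1_choi X Y (T : op R Y Y -> op R X X) (sigma : op R Y Y) :
  (forall M, \tr (T M) = \tr M) ->
  \tr (tens (1%:M : op R X X) sigma *m choi_adjoint T) = \tr sigma.
Proof.
move=> tp; rewrite !trace_ent.
transitivity (\sum_(b : Y) \sum_(b' : Y) ent sigma b b' *
    \sum_(a : X) ent (choi_adjoint T) (a, b') (a, b)).
  transitivity (\sum_a \sum_b \sum_(b' : Y)
      ent sigma b b' * ent (choi_adjoint T) (a, b') (a, b)); last first.
    rewrite exchange_big /=; apply: eq_bigr => b _.
    rewrite exchange_big /=; apply: eq_bigr => b' _.
    by rewrite big_distrr.
  rewrite sum_pair; apply: eq_bigr => a _; apply: eq_bigr => b _.
  rewrite ent_mulmx sum_pair (bigD1 a) //= [X in _ + X]big1 ?addr0.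
    by apply: eq_bigr => b' _; rewrite ent_mkop /= ent_scalar eqxx mul1r.
  move=> a' aa'; rewrite big1 // => b' _; rewrite ent_mkop /= ent_scalar.
  by rewrite eq_sym (negPf aa') !mul0r.
apply: eq_bigr => b _; rewrite (bigD1 b) //= choi_trace // eqxx mulr1.
by rewrite big1 ?addr0 // => b' bb'; rewrite choi_trace // (negPf bb') mulr0.
Qed.

End Entries.

(** * Counting channels *)

Section Restriction.
Variables (W' W : finType) (j : W' -> W).
Hypothesis jI : injective j.

Definition restr (x : bits W) : bits W' := [ffun w => x (j w)].

Definition agree_off (y x : bits W) : bool :=
  [forall w, (w \notin codom j) ==> (y w == x w)].

Definition extend (u : bits W') (x : bits W) : bits W :=
  [ffun w => if [pick w' | j w' == w] is Some w' then u w' else x w].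

Lemma extendK u x : restr (extend u x) = u.
Proof.
apply/ffunP => w; rewrite !ffunE; case: pickP => [w' /eqP/jI -> //|/(_ w)].
by rewrite eqxx.
Qed.

Lemma agree_extend u x : agree_off (extend u x) x.
Proof.
apply/forallP => w; apply/implyP => wj; rewrite ffunE.
case: pickP => [w' /eqP e|//]; by rewrite -e codom_f in wj.
Qed.

Lemma extend_restr y x : agree_off y x -> extend (restr y) x = y.
Proof.
move=> /forallP yx; apply/ffunP => w; rewrite !ffunE; case: pickP => [w' /eqP <-|h].
  by rewrite ffunE.
have /implyP/(_ _)/eqP-> // := yx w.
by apply/negP => /codomP[w' e]; have := h w'; rewrite e eqxx.
Qed.

Lemma sum_agree (V : nmodType) (f : bits W -> V) x :
  \sum_(u | agree_off u x) f u = \sum_u f (extend u x).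
Proof.
rewrite (reindex (fun u => extend u x)) /=; last first.
  exists restr => u; first by rewrite extendK.
  by move=> /extend_restr.
by apply: eq_bigl => u; rewrite agree_extend.
Qed.

Lemma agree_off_trans y u x : agree_off u x -> agree_off y u = agree_off y x.
Proof.
move=> /forallP h; apply: eq_forallb => w; have /implyP := h w.
by case: (w \notin _) => //= /(_ isT)/eqP ->.
Qed.

End Restriction.

Section Push.
Variables (R : realType) (I : finType) (G : I -> gate R).
Variables (W' W : finType) (j : W' -> W).
Hypothesis jI : injective j.

Definition push_gate (g : gate_app G W') : gate_app G W :=
  @GateApp R I G W (app_gate g) (j \o @app_wire R I G W' g) (inj_comp jI (@app_inj R I G W' g)).

(** Wires outside the image of [j] stay idle, so the relabelled gate is the original one tensored
    with the identity. *)
Lemma app_mx_push g y x :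
  ent (app_mx (push_gate g)) y x =
  ent (app_mx g) (restr j y) (restr j x) * (agree_off j y x)%:R.
Proof.
rewrite !ent_mkop /= -mulrA; congr (_ * _).
  by congr (ent _ _ _); apply/ffunP => i; rewrite !ffunE.
rewrite -natrM mulnb; congr (_%:R); congr nat_of_bool.
apply/forallP/andP => [h|[/forallP h1 /forallP h2] w].
  split; apply/forallP => w; apply/implyP => hw.
    rewrite !ffunE; apply: (implyP (h (j w))); apply: contra hw.
    by move=> /codomP[i /jI ->]; apply: codom_f.
  by apply: (implyP (h w)); apply: contra hw => /codomP[i ->]; apply: codom_f.
apply/implyP => hw; case: (boolP (w \in codom j)) => [/codomP[w' e]|wj].
  have := h1 w'; rewrite !ffunE -e => /implyP; apply.
  by apply: contra hw => /codomP[i ei]; apply/codomP; exists i; rewrite e ei.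
exact: (implyP (h2 w)).
Qed.

Lemma apps_mx_rcons (V : finType) (s : seq (gate_app G V)) g :
  apps_mx (rcons s g) = app_mx g *m apps_mx s.
Proof. by rewrite /apps_mx foldl_rcons. Qed.

Lemma apps_mx_push s y x :
  ent (apps_mx (map push_gate s)) y x =
  ent (apps_mx s) (restr j y) (restr j x) * (agree_off j y x)%:R.
Proof.
elim/last_ind: s y x => [|s g IHs] y x.
  rewrite /apps_mx /= !ent_scalar -natrM mulnb; congr (_%:R); congr nat_of_bool.
  apply/eqP/andP => [->|[/eqP e yx]].
    by rewrite eqxx; split=> //; apply/forallP => w; rewrite eqxx implybT.
  rewrite -(extend_restr yx) e extend_restr // /agree_off.
  by apply/forallP => w; rewrite eqxx implybT.
rewrite map_rcons !apps_mx_rcons !ent_mulmx.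
under eq_bigr do rewrite app_mx_push IHs.
rewrite (bigID (fun u => agree_off j u x)) /= [X in _ + X]big1 ?addr0 => [|u /negPf ->]; last first.
  by rewrite !mulr0.
rewrite (sum_agree jI) big_distrl /=; apply: eq_bigr => u _.
rewrite extendK // agree_extend mulr1 (agree_off_trans y (agree_extend j u x)).
by rewrite mulrAC.
Qed.

End Push.

Section Channel.
Variables (R : realType) (I : finType) (G : I -> gate R) (WA WB : finType).

Definition input E (b : bits WB) : bits (WB + 'I_E)%type := merge_bits b [ffun=> false].

(* The entries of the Choi operator of a circuit, through its gate list and the
   wires [o] output to A' alone: here an idle ancilla wire can be dropped. *)
Definition chan E (s : seq (gate_app G (WB + 'I_E)%type)) (o : WA -> WB + 'I_E)
    (z z' : bits WA * bits WB) : R[i] :=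
  \sum_(u | restr o u == z.1) \sum_(u' | (restr o u' == z'.1) && agree_off o u' u)
    (ent (apps_mx s) u (input E z.2))^* * ent (apps_mx s) u' (input E z'.2).

(** Idle wires are ancillas holding 0 in both inputs, so they keep that value in both amplitudes and
    pass the test [agree_off] automatically; the sums collapse to strings on the smaller
    register. *)
Lemma chan_push E' E (j : WB + 'I_E' -> WB + 'I_E) (jI : injective j)
    (s : seq (gate_app G (WB + 'I_E')%type)) (o : WA -> WB + 'I_E') :
  (forall b, j (inl b) = inl b) -> (forall e, exists e', j (inr e) = inr e') ->
  chan (map (push_gate jI) s) (j \o o) =2 chan s o.
Proof.
move=> jl jr [a b] [a' b']; rewrite /chan /=.
have restr_input b0 : restr j (input E b0) = input E' b0.
  apply/ffunP => -[w|e]; rewrite !ffunE ?jl //.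
  by have [e' ->] := jr e; rewrite !ffunE.
have restrM u : restr (j \o o) u = restr o (restr j u).
  by apply/ffunP => w; rewrite !ffunE.
have inputs : agree_off j (input E b') (input E b).
  apply/forallP => -[w|e]; apply/implyP; last by rewrite !ffunE.
  by rewrite -jl codom_f.
pose f x (u : bits (WB + 'I_E)%type) := ent (apps_mx s) (restr j u) (input E' x).
transitivity (\sum_(u | agree_off j u (input E b)) \sum_(u' | agree_off j u' (input E b'))
  ((restr o (restr j u) == a) && (restr o (restr j u') == a') &&
   agree_off o (restr j u') (restr j u))%:R * ((f b u)^* * f b' u')).
  rewrite big_mkcond [RHS]big_mkcond; apply: eq_bigr => u _ /=.
  rewrite restrM; case: (boolP (agree_off j u _)) => ub; last first.
    rewrite big1 ?if_same // => u' _.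
    by rewrite apps_mx_push (negPf ub) mulr0 conjC0 mul0r.
  case: eqP => ha; last by rewrite big1 // => u' _; rewrite mul0r.
  rewrite big_mkcond [RHS]big_mkcond; apply: eq_bigr => u' _ /=.
  rewrite restrM; case: (boolP (agree_off j u' _)) => ub'; last first.
    by rewrite !apps_mx_push (negPf ub') !mulr0 if_same.
  rewrite !apps_mx_push ub ub' !mulr1 !restr_input.
  have -> : agree_off (j \o o) u' u = agree_off o (restr j u') (restr j u).
    apply/forallP/forallP => h w; apply/implyP => hw.
      rewrite !ffunE; apply: (implyP (h (j w))); apply: contra hw.
      by move=> /codomP[i /jI ->]; apply: codom_f.
    case: (boolP (w \in codom j)) => [/codomP[w' e]|wj].
      have := h w'; rewrite !ffunE -e => /implyP; apply.
      by apply: contra hw => /codomP[i ei]; apply/codomP; exists i; rewrite e ei.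
    rewrite (eqP (implyP (forallP ub w) wj)) (eqP (implyP (forallP ub' w) wj)).
    exact: (implyP (forallP inputs w)).
  by case: (_ && _); rewrite ?mul1r ?mul0r.
rewrite (sum_agree jI) [RHS]big_mkcond; apply: eq_bigr => u _ /=.
rewrite (sum_agree jI) /= extendK //.
under eq_bigr do rewrite extendK // /f !extendK //.
case: eqP => _; last by rewrite big1 // => u' _; rewrite mul0r.
rewrite [RHS]big_mkcond; apply: eq_bigr => u' _ /=.
by case: (_ && _); rewrite ?mul1r ?mul0r.
Qed.

Lemma ent_zero_state (W : finType) (y x : bits W) :
  ent (zero_state R W) y x = ((y == [ffun=> false]) && (x == [ffun=> false]))%:R.
Proof. exact: ent_mkop. Qed.

(** The conjugated entries of the Kraus operator for the value [k] of the discarded register [K]. *)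
Definition circuit_amp (c : circuit G WB WA) (k : bits 'I_(nK c))
    (z : bits WA * bits WB) : R[i] :=
  (ent (apps_mx (gates c)) [ffun w => merge_bits z.1 k (output w)] (input (nE c) z.2))^*.

(** Tracing out [K] sums over Kraus operators, which makes the Choi operator a Gram matrix with one
    vector per value of [K]. *)
Lemma choi_circuit (c : circuit G WB WA) T :
  (forall rho, T rho = circuit_map c rho) ->
  forall z z', ent (choi_adjoint T) z z' = gram (@circuit_amp c) z z'.
Proof.
move=> Tc [a b] [a' b']; rewrite ent_choi Tc /circuit_map ent_mkop /gram rmorph_sum.
apply: eq_bigr => k _; rewrite ent_mulmx /=.
pose z0 : bits 'I_(nE c) := [ffun=> false].
have key x : ent (circuit_mx c *m tens (delta_mx (enum_rank b) (enum_rank b'))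
     (zero_state R 'I_(nE c))) (a, k) x =
   ent (circuit_mx c) (a, k) (b, z0) * (x == (b', z0))%:R.
  rewrite ent_mulmx (bigD1 (b, z0)) //= big1 ?addr0 => [|y yb].
    rewrite ent_tens /= ent_delta ent_zero_state !eqxx /= -natrM mulnb.
    by case: x => x1 x2; rewrite xpair_eqE.
  rewrite ent_tens /= ent_delta ent_zero_state -natrM mulnb.
  case: y yb => y1 y2; rewrite xpair_eqE negb_and => /orP[/negPf e|/negPf e] /=.
    by rewrite e mulr0.
  by rewrite e andbF mulr0.
rewrite (bigD1 (b', z0)) //= big1 ?addr0 => [|x /negPf xb]; last by rewrite key xb mulr0 mul0r.
by rewrite key eqxx mulr1 ent_adjmx !ent_mkop /= rmorphM /= conjCK.
Qed.

(** Tracing out [K] asks exactly that the two strings agree off the wires leading to [A'], so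
    [output] enters through the preimages of those wires. *)
Lemma gram_circuit_amp (c : circuit G WB WA) :
  exists2 o, injective o & gram (@circuit_amp c) =2 chan (gates c) o.
Proof.
have [inv outK invK] := output_bij c.
exists (inv \o inl) => [x y /(can_inj invK) [] //|[a b] [a' b']].
rewrite /gram /chan /=.
pose U (p : bits WA * bits 'I_(nK c)) : bits (WB + 'I_(nE c))%type :=
  [ffun w => merge_bits p.1 p.2 (output w)].
have U_bij : bijective U.
  exists (fun u : bits (WB + 'I_(nE c))%type =>
    ([ffun w => u (inv (inl w))] : bits WA, [ffun w => u (inv (inr w))] : bits 'I_(nK c))).
    by move=> [x y]; congr pair; apply/ffunP => w; rewrite !ffunE invK.
  move=> u; apply/ffunP => w; rewrite !ffunE.
  by case e : (output w) => [x|x]; rewrite ffunE -e outK.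
have restrU p : restr (inv \o inl) (U p) = p.1.
  by apply/ffunP => w; rewrite !ffunE /= invK.
have agreeU p p' : agree_off (inv \o inl) (U p') (U p) = (p'.2 == p.2).
  apply/forallP/eqP => [h|h w].
    apply/ffunP => w; have /implyP := h (inv (inr w)); rewrite !ffunE invK => e.
    apply/eqP/e; apply/negP => /codomP[x /= /(can_inj invK)]; by [].
  apply/implyP => hw; rewrite !ffunE; case e : (output w) => [x|x]; last by rewrite h.
  by case/negP: hw; apply/codomP; exists x; rewrite /= -e outK.
rewrite (reindex _ (onW_bij _ U_bij)) /=.
under [RHS]eq_bigl do rewrite restrU.
rewrite [RHS]big_mkcond sum_pair (bigD1 a) //= [X in _ = _ + X]big1 ?addr0; last first.
  by move=> a0 /negPf a0a; rewrite big1 // => k _; rewrite a0a.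
apply: eq_bigr => k _; rewrite eqxx.
rewrite (reindex _ (onW_bij _ U_bij)) /=.
rewrite (big_pred1 (a', k)) => [|p]; last by rewrite restrU agreeU.
by rewrite /circuit_amp /= conjCK.
Qed.

End Channel.

(** * Encoding circuits by finite codes *)

Section Counting.
Variables (R : realType) (I : finType) (G : I -> gate R).

Definition wires (W : finType) (g : gate_app G W) : 'I_(arity (G (app_gate g))) -> W :=
  @app_wire R I G W g.

Arguments wires {W} g i.

Lemma gate_app_eq (W : finType) i (f f' : 'I_(arity (G i)) -> W) fI f'I :
  f =1 f' -> @GateApp R I G W i f fI = @GateApp R I G W i f' f'I.
Proof. by move=> /funext e; subst f'; congr GateApp; exact: Prop_irrelevance. Qed.

Lemma pull_gate (W' W : finType) (j : W' -> W) (jI : injective j) (g : gate_app G W) :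
  (forall i, wires g i \in codom j) -> exists g', push_gate jI g' = g.
Proof.
case: g => i f fI; rewrite /wires /= => fj.
have f'I : injective (fun t => iinv (fj t)).
  by move=> t1 t2 e; apply: fI; rewrite -(f_iinv (fj t1)) e f_iinv.
by exists (GateApp f'I); apply: gate_app_eq => t /=; rewrite f_iinv.
Qed.

Lemma pull_gates (W' W : finType) (j : W' -> W) (jI : injective j) (s : seq (gate_app G W)) :
  (forall w, w \in flatten [seq codom (wires g) | g <- s] -> w \in codom j) ->
  exists s', map (push_gate jI) s' = s.
Proof.
elim: s => [|g s IHs] h; first by exists [::].
have [|s' <-] := IHs; first by move=> w ws; apply: h; rewrite /= mem_cat ws orbT.
have [|g' <-] := @pull_gate _ _ _ jI g.
  by move=> i; apply: h; rewrite /= mem_cat codom_f.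
by exists (g' :: s').
Qed.

Variable a : nat.
Hypothesis arity_le : forall i, (arity (G i) <= a)%N.

Lemma size_wires_le (W : finType) (s : seq (gate_app G W)) :
  (size (flatten [seq codom (wires g) | g <- s]) <= size s * a)%N.
Proof.
elim: s => //= g s IHs; rewrite size_cat mulSn leq_add //.
by rewrite size_codom card_ord.
Qed.

Variables (WA WB : finType) (S : nat).
(** As many ancillas as [S] gates of arity at most [a] and the outputs can touch. *)
Let L := (S * a + #|WA|)%N.

(** Ancillas met by no gate and no output can be discarded; the others number at most [L], so the
    circuit is pulled back to them and pushed into [L] ancillas, [chan_push] preserving the channel
    both times. *)
Lemma chan_normal E (s : seq (gate_app G (WB + 'I_E)%type)) (o : WA -> WB + 'I_E) :
  (size s <= S)%N ->
  exists (s' : seq (gate_app G (WB + 'I_L)%type)) (o' : WA -> WB + 'I_L),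
    (size s' <= S)%N /\ chan s' o' =2 chan s o.
Proof.
move=> sS.
pose used := flatten [seq codom (wires g) | g <- s] ++ codom o.
pose Q := [set e : 'I_E | inr e \in used].
have QL : (#|Q| <= L)%N.
  have -> : #|Q| = #|[set (inr e : (WB + 'I_E)%type) | e in Q]|.
    by rewrite card_imset // => x y [].
  have sub : [set (inr e : (WB + 'I_E)%type) | e in Q] \subset used.
    by apply/fintype.subsetP => w /imsetP[e]; rewrite inE => eu ->.
  apply: leq_trans (subset_leq_card sub) _.
  apply: leq_trans (card_size _) _; rewrite size_cat size_codom leq_add2r.
  by apply: leq_trans (size_wires_le s) _; rewrite leq_mul2r sS orbT.
pose j (w : (WB + 'I_#|Q|)%type) : (WB + 'I_E)%type :=
  match w with inl b => inl b | inr i => inr (enum_val i) end.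
have jI : injective j by move=> [x|x] [y|y] //= [] => [->|/enum_val_inj ->].
have used_j w : w \in used -> w \in codom j.
  case: w => [b|e] eu; first by apply/codomP; exists (inl b).
  have eQ : e \in Q by rewrite inE.
  by apply/codomP; exists (inr (enum_rank_in eQ e)); rewrite /= enum_rankK_in.
have [|s1 s1E] := @pull_gates _ _ j jI s.
  by move=> w ws; apply: used_j; rewrite mem_cat ws.
have oj w : o w \in codom j by apply: used_j; rewrite mem_cat codom_f orbT.
pose o1 w := iinv (oj w).
have o1E : o = j \o o1 by apply: funext => w; rewrite /= f_iinv.
pose i (w : (WB + 'I_#|Q|)%type) : (WB + 'I_L)%type :=
  match w with inl b => inl b | inr e => inr (widen_ord QL e) end.
have iI : injective i.
  by move=> [x|x] [y|y] //= [] => [->//|e]; congr inr; apply: val_inj.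
exists (map (push_gate iI) s1), (i \o o1); split.
  by rewrite size_map -(size_map (push_gate jI)) s1E.
move=> z z'; rewrite chan_push //; last by move=> e; exists (widen_ord QL e).
by rewrite -s1E o1E chan_push // => e; exists (enum_val e).
Qed.

Let W := (WB + 'I_L)%type.
(** Wire lists are padded with [None] to length [a], so that gate applications, whose wires depend
    on the gate, inject into one finite type. *)
Let code := (I * {ffun 'I_a -> option W})%type.

Let encode (g : gate_app G W) : code :=
  (app_gate g, [ffun t : 'I_a => omap (wires g) (insub (val t))]).

Let encode_inj : injective encode.
Proof.
case=> i f fI [i' f' f'I] [] /= e; subst i' => /ffunP h; apply: gate_app_eq => t.
have := h (widen_ord (arity_le i) t); rewrite !ffunE /= /wires /=.
have -> : insub (val t) = Some t :> option 'I_(arity (G i)) by exact: valK.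
by case.
Qed.

Let decode (c : code) : option (gate_app G W) :=
  if pselect (exists g, encode g = c) is left h then Some (sval (cid h)) else None.

Let encodeK : pcancel encode decode.
Proof.
move=> g; rewrite /decode; case: pselect => [h|[]]; last by exists g.
by congr Some; apply: encode_inj; case: (cid h).
Qed.

(** By [chan_normal] a channel is determined by at most [S] gates on [#|WB| + L] wires, padded to a
    list of length [S], and by its output wires. The exponent comes from applying [m < 2^m] to each
    factor. *)
Lemma channel_count :
  exists (T : finType) (F : T -> bits WA * bits WB -> bits WA * bits WB -> R[i]),
    (#|T| <= 2 ^ (S * (1 + #|I| + a * (#|WB| + L).+1) + (#|WB| + L) * #|WA|))%N /\
    forall (c : circuit G WB WA), (size (gates c) <= S)%N ->
      exists t, F t =2 gram (@circuit_amp R I G WA WB c).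
Proof.
exists (S.-tuple (option code) * {ffun WA -> W})%type.
exists (fun t : S.-tuple (option code) * {ffun WA -> W} =>
  chan (pmap (obind decode) t.1) t.2); split.
  rewrite card_prod card_tuple card_option card_ffun card_prod card_ffun card_option.
  rewrite card_ord card_sum card_ord.
  have lt2 m : (m.+1 <= 2 ^ m)%N by rewrite ltn_expl.
  rewrite expnD leq_mul //.
    rewrite [(S * _)%N]mulnC [X in (_ <= X)%N]expnM; apply: leq_exp2rW.
    have h : (#|I| * ((#|WB| + L).+1 ^ a) <= 2 ^ (#|I| + a * (#|WB| + L).+1))%N.
      rewrite expnD leq_mul //; first by rewrite ltnW // lt2.
      by rewrite mulnC expnM; apply: leq_exp2rW; rewrite ltnW // lt2.
    rewrite -addnA expnD mul2n -addnn -[X in (X <= _)%N]addn1 leq_add // expn_gt0 //.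
  by rewrite expnM; apply: leq_exp2rW; rewrite ltnW // lt2.
move=> c cS; have [f fI fE] := gram_circuit_amp c.
have [s [f' [sS h]]] := chan_normal f cS.
have tP : size (map (fun g => Some (encode g)) s ++ nseq (S - size s) None) == S.
  by rewrite size_cat size_map size_nseq subnKC.
exists (Tuple tP, finfun f') => z z'; rewrite fE -h /=.
have -> : pmap (obind decode) (map (fun g => Some (encode g)) s ++ nseq (S - size s) None) = s.
  rewrite pmap_cat [X in _ ++ X](_ : _ = [::]) ?cats0; last by elim: (S - size s)%N.
  by elim: (s) => //= g s1 ->; rewrite /= encodeK.
by congr (chan _ _ _ _); apply: funext => w; rewrite ffunE.
Qed.

End Counting.

Local Open Scope classical_set_scope.
Local Open Scope ring_scope.

(** * Entropy bounds *)

Section Entropies.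
Variable R : realType.
Local Notation C := R[i].
Local Notation "x %:C" := (real_complex R x).

Lemma ler_real_complex (x y : R) : (x%:C <= y%:C) = (x <= y).
Proof. exact: lecR. Qed.

Lemma elog2_ge (e : R) (x : \bar R) : ((2 `^ e)%:E <= x)%E -> (e%:E <= elog2 x)%E.
Proof.
have l2 : 0 < ln 2 :> R by rewrite ln_gt0 // ltr1n.
case: x => [r||] //= h; last by rewrite /elog2 /= gt0_mulye ?leey // lte_fin invr_gt0.
rewrite lee_fin in h.
have r0 : 0 < r by apply: lt_le_trans h; rewrite powR_gt0.
rewrite /elog2 lne_EFin // -EFinM lee_fin ler_pdivlMr // -ln_powR ler_ln ?posrE ?powR_gt0 //.
Qed.

Lemma expectation_tens1 (X Y : finType) (v : X * Y -> C) (sigma : op R Y Y) :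
  \sum_b \sum_b' (v b)^* * ent (tens (1%:M : op R X X) sigma) b b' * v b' =
  \sum_y \sum_y' ent sigma y y' * \sum_x (v (x, y))^* * v (x, y').
Proof.
rewrite sum_pair exchange_big /=; apply: eq_bigr => y _.
under [RHS]eq_bigr do rewrite big_distrr /=.
rewrite [RHS]exchange_big /=; apply: eq_bigr => x _.
rewrite sum_pair (bigD1 x) //= [X in _ + X]big1 ?addr0 => [|x' /negPf xx'].
  by apply: eq_bigr => y' _; rewrite ent_tens /= ent_scalar eqxx mul1r; ring.
by apply: big1 => y' _; rewrite ent_tens /= ent_scalar eq_sym xx' mul0r mulr0 mul0r.
Qed.

(** The condition on [v] says that its reduced operator on [Y] is [mu] times the identity, so
    [1 (x) sigma] has expectation [mu] for every density [sigma], and any admissible [lambda]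
    satisfies [lambda mu >= 2^e mu]. *)
Lemma Hmin_le (X Y : finType) (rho : op R (X * Y)%type (X * Y)%type)
    (v : X * Y -> C) (mu e : R) :
  0 < mu ->
  (forall y y', \sum_x (v (x, y))^* * v (x, y') = mu%:C *+ (y == y')) ->
  (2 `^ e * mu)%:C <= \sum_b \sum_b' (v b)^* * ent rho b b' * v b' ->
  (Hmin rho <= (- e)%:E)%E.
Proof.
move=> mu0 vv low; rewrite /Hmin EFinN leeN2.
apply: le_ereal_inf_tmp => _ [sigma [sigma_psd sigma_tr] <-].
apply: elog2_ge; apply: le_ereal_inf_tmp => _ [l [l0 [_ le]] <-].
rewrite lee_fin -(ler_pM2r mu0) -ler_real_complex (le_trans low) //.
rewrite -subr_ge0; have := le (ket v); rewrite expectation_ent.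
set lhs := (X in 0 <= X -> _) => lhs0; rewrite (_ : _ - _ = lhs) // /lhs.
have ketE b : ket v (enum_rank b) 0 = v b by rewrite mxE enum_rankK.
transitivity (l%:C * (\sum_b \sum_b' (v b)^* * ent (tens (1%:M : op R X X) sigma) b b' * v b')
    - \sum_b \sum_b' (v b)^* * ent rho b b' * v b').
  congr (_ - _); rewrite expectation_tens1 rmorphM /=; congr (_ * _).
  transitivity (mu%:C * \tr sigma); first by rewrite sigma_tr mulr1.
  rewrite trace_ent big_distrr /=; apply: eq_bigr => y _.
  rewrite (bigD1 y) //= vv eqxx mulr1n big1 ?addr0 1?mulrC // => y' /negPf yy'.
  by rewrite vv eq_sym yy' mulr0n mulr0.
rewrite big_distrr /= -sumrB; apply: eq_bigr => b _.
rewrite big_distrr /= -sumrB; apply: eq_bigr => b' _.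
by rewrite !ketE ent_add ent_opp ent_scale; ring.
Qed.

(** One [sigma] suffices for this direction, and the maximally mixed one is taken. The traces
    against [1 (x) sigma] are 1 on [J], and a linear inequality passes from [J] to the cone it
    generates. *)
Lemma cone_Hmin_ge (X Y : finType) (J : set (op R (X * Y)%type (X * Y)%type))
    (rho : op R (X * Y)%type (X * Y)%type) (e : R) :
  (0 < #|Y|)%N ->
  (forall F, J F -> \tr (rho *m F) <= (2 `^ (- e))%:C) ->
  (forall F sigma, J F -> \tr (tens (1%:M : op R X X) sigma *m F) = \tr sigma) ->
  (e%:E <= cone_Hmin (cone J) rho)%E.
Proof.
move=> Y0 hJ trJ; rewrite /cone_Hmin leeNr -EFinN.
have YC : #|Y|%:R != 0 :> C by rewrite pnatr_eq0 -lt0n.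
pose sigma : op R Y Y := (#|Y|%:R^-1)%:M.
have sigma1 : \tr sigma = 1 by rewrite mxtrace_scalar -[_ *+ _]mulr_natl divff.
have sigma_density : density sigma.
  split=> //; split.
    apply: op_ext => x y; rewrite ent_adjmx !ent_scalar rmorphMn /= eq_sym.
    by congr (_ *+ _); apply: conj_Creal; rewrite realV realn.
  move=> v; rewrite expectation_ent; apply: sumr_ge0 => x _.
  apply: sumr_ge0 => y _; rewrite ent_scalar; case: eqP => [->|_]; last first.
    by rewrite mulr0n mulr0 mul0r.
  by rewrite mulr1n mulrAC [_^* * _]mulrC -normCK mulr_ge0 ?exprn_ge0 // invr_ge0 ler0n.
apply: (@le_trans _ _ (cone_Dmax (cone J) rho (tens (1%:M : op R X X) sigma))).
  by apply: ereal_inf_lbound; exists sigma.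
apply: ereal_inf_lbound; exists (- e) => //=.
pose K := [set F : op R (X * Y)%type (X * Y)%type | \tr (rho *m F) <=
  \tr (((2 `^ (- e))%:C *: tens (1%:M : op R X X) sigma) *m F)].
suff h : cone J `<=` K by exact: h.
apply: smallest_sub => [|G JG /=].
  split=> [M N hM hN|t M t0 hM].
    by move: hM hN; rewrite /K /= => hM hN; rewrite !mulmxDr !mxtraceD lerD.
  move: hM; rewrite /K /= => hM.
  by rewrite -!scalemxAr !mxtraceZ ler_wpM2l // -[0]/(0%:C) ler_real_complex.
by rewrite /K /= -scalemxAl mxtraceZ trJ // sigma1 mulr1 hJ.
Qed.

End Entropies.

(** * The random state *)

Section Hadamard.
Variables (C : numClosedFieldType) (h : nat).

Definition chi (x y : bits 'I_h) : C := \prod_(i < h) (-1) ^+ (x i && y i).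

Lemma chi_norm x y : `|chi x y| = 1.
Proof. by rewrite normr_prod big1 // => i _; rewrite normrX normrN1 expr1n. Qed.

Lemma chi_real x y : (chi x y)^* = chi x y.
Proof.
by apply: conj_Creal; apply: rpred_prod => i _; apply: rpredX; rewrite rpredN rpred1.
Qed.

(** The sum factors over the bits, and a bit where [y] and [y'] differ gives [1 - 1 = 0]. *)
Lemma chi_orth y y' : \sum_x chi x y * chi x y' = (2 ^ h)%:R *+ (y == y').
Proof.
under eq_bigr do rewrite /chi -big_split /=.
rewrite -(bigA_distr_bigA (fun i b => (-1) ^+ (b && y i) * (-1) ^+ (b && y' i))) /=.
under eq_bigr do rewrite big_bool /= !expr0 mulr1.
case: eqP => [<-|yy'].
  rewrite mulr1n natrX -[in RHS](card_ord h) -prodr_const; apply: eq_bigr => i _.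
  by rewrite -expr2 sqrr_sign.
have [i yi] : exists i, y i != y' i.
  apply/existsP; apply: contra_notT yy'; rewrite negb_exists => /forallP e.
  by apply/ffunP => i; apply/eqP; have := e i; rewrite negbK.
rewrite mulr0n (bigD1 i) //=.
by move: yi; case: (y i); case: (y' i) => // _; rewrite /= !expr0 !expr1 ?mul1r ?mulr1 addNr mul0r.
Qed.

End Hadamard.

Lemma sum_copies (V : comPzSemiRingType) (k : nat) (W : finType) (f : 'I_k -> bits W -> V) :
  \sum_(x : bits ('I_k * W)) \prod_i f i [ffun w => x (i, w)] = \prod_i \sum_u f i u.
Proof.
rewrite bigA_distr_bigA /=.
rewrite (reindex (fun x : bits ('I_k * W) => [ffun i => [ffun w => x (i, w)]])) /=.
  by apply: eq_bigr => x _; apply: eq_bigr => i _; rewrite ffunE.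
exists (fun g : {ffun 'I_k -> bits W} => [ffun p => g p.1 p.2]) => x _.
  by apply/ffunP => -[i w]; rewrite !ffunE.
by apply/ffunP => i; apply/ffunP => w; rewrite !ffunE.
Qed.

Section State.
Variables (R : realType) (h M r : nat) (w : R[i]).
Local Notation C := R[i].
Local Notation "x %:C" := (real_complex R x).
Hypotheses (wr : r.-primitive_root w) (r0 : (0 < r)%N) (M0 : (0 < M)%N).
Variable s : phases (bits 'I_h) (bits 'I_h) M r.

Local Notation amps := (amp (@chi C h) w s).

Lemma amp_norm c x y : `|amps c x y| = 1.
Proof. by rewrite /amp !normrM chi_norm !normrX (norm_prim_root r0 wr) !expr1n !mulr1. Qed.

(** The phase of [x] cancels and those of [y] and [y'] come out of the sum, leaving the
    orthogonality of the Hadamard matrix; so each [psi_c] is maximally entangled. *)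
Lemma amp_orth c y y' : \sum_x (amps c x y)^* * amps c x y' = (2 ^ h)%:R *+ (y == y').
Proof.
have regroup (a b c1 d p q : C) : a * b = 1 -> a * c1 * p * (b * d * q) = c1 * d * (p * q).
  by move=> ab; rewrite -[RHS]mul1r -ab; ring.
have ww n : (w ^+ n)^* * w ^+ n = 1.
  by rewrite mulrC -normCK normrX (norm_prim_root r0 wr) !expr1n.
transitivity ((w ^+ s.2 (c, y))^* * w ^+ s.2 (c, y') * \sum_x chi C x y * chi C x y').
  rewrite big_distrr /=; apply: eq_bigr => x _.
  rewrite /amp !rmorphM /= chi_real.
  exact/regroup/ww.
by rewrite chi_orth; case: eqP => [<-|_]; rewrite ?mulr0n ?mulr0 ?ww ?mul1r.
Qed.

Definition state : op R (bits 'I_h * bits 'I_h)%type (bits 'I_h * bits 'I_h)%type :=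
  (M * 4 ^ h)%:R^-1 *: mkop (gram (fun c z => amps c z.1 z.2)).

Lemma card_bits (W : finType) : #|{: bits W}| = (2 ^ #|W|)%N.
Proof. by rewrite card_ffun card_bool. Qed.

Lemma state_density : density state.
Proof.
have d0 : 0 < (M * 4 ^ h)%:R :> C by rewrite ltr0n muln_gt0 M0 expn_gt0.
split; last first.
  rewrite mxtraceZ trace_ent; under eq_bigr do rewrite ent_mkop /gram.
  under eq_bigr do under eq_bigr do rewrite -normCK amp_norm expr1n.
  under eq_bigr do rewrite sumr_const card_ord.
  rewrite sumr_const -mulrnA card_prod card_bits card_ord -expnMn mulVf //.
  by rewrite gt_eqF.
have [sa pos] := psd_gram (fun c (z : bits 'I_h * bits 'I_h) => amps c z.1 z.2).
split.
  apply: op_ext => x y; have := congr1 (fun N => ent N x y) sa.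
  rewrite !ent_adjmx !ent_scale rmorphM /= => ->; congr (_ * _).
  by apply: conj_Creal; rewrite realV realn.
move=> v; rewrite -scalemxAr -scalemxAl mxE mulr_ge0 ?pos //.
Qed.

Variable k : nat.
Local Notation Bk := (bits ('I_k * 'I_h) * bits ('I_k * 'I_h))%type.

Definition copyA (b : Bk) (i : 'I_k) : bits 'I_h := [ffun w => b.1 (i, w)].
Definition copyB (b : Bk) (i : 'I_k) : bits 'I_h := [ffun w => b.2 (i, w)].

Lemma copy_inj b1 b2 : copyA b1 =1 copyA b2 -> copyB b1 =1 copyB b2 -> b1 = b2.
Proof.
case: b1 b2 => [x1 y1] [x2 y2] hA hB; congr pair; apply/ffunP => -[i u].
  by have /ffunP/(_ u) := hA i; rewrite !ffunE.
by have /ffunP/(_ u) := hB i; rewrite !ffunE.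
Qed.

Lemma ent_tens_pow_state b b' :
  ent (tens_pow k state) b b' =
  (M * 4 ^ h)%:R^-1 ^+ k * copies (@chi C h) w copyA copyB s b b'.
Proof.
rewrite ent_mkop -[in _ ^+ k](card_ord k) -prodr_const -big_split /=.
by apply: eq_bigr => i _; rewrite ent_scale ent_mkop.
Qed.

Lemma trace_tens_pow_state (F : op R Bk Bk) :
  \tr (tens_pow k state *m F) =
  (M * 4 ^ h)%:R^-1 ^+ k *
  \sum_b \sum_b' copies (@chi C h) w copyA copyB s b b' * ent F b' b.
Proof.
rewrite trace_ent big_distrr /=; apply: eq_bigr => b _.
rewrite ent_mulmx big_distrr /=; apply: eq_bigr => b' _.
by rewrite ent_tens_pow_state mulrA.
Qed.

(** The unnormalised vector [psi_c^k], all copies having the same colour. *)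
Let test (c : 'I_M) (b : Bk) : C := \prod_i amps c (copyA b i) (copyB b i).

Let test_orth c y y' :
  \sum_x (test c (x, y))^* * test c (x, y') = (2 ^ (k * h))%:R *+ (y == y').
Proof.
transitivity (\prod_(i < k) \sum_u
   (amps c u (copyB (y, y) i))^* * amps c u (copyB (y', y') i)).
  rewrite -sum_copies; apply: eq_bigr => x _.
  by rewrite /test rmorph_prod -big_split.
under eq_bigr do rewrite amp_orth.
case: eqP => [<-|yy'].
  under eq_bigr do rewrite eqxx mulr1n.
  by rewrite prodr_const card_ord -natrX mulr1n mulnC expnM.
have /existsP[i /negPf e] : [exists i, copyB (y, y) i != copyB (y', y') i].
  apply: contra_notT yy'; rewrite negb_exists => /forallP e.
  apply/ffunP => -[i u]; have := e i; rewrite negbK => /eqP/ffunP/(_ u).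
  by rewrite !ffunE.
by rewrite (bigD1 i) //= e mulr0n mul0r.
Qed.

Let test_norm c b : `|test c b| = 1.
Proof. by rewrite normr_prod big1 // => i _; rewrite amp_norm. Qed.

(** In the expansion of [rho^k] over colour strings every term is nonnegative, and the constant
    string [c] alone contributes this value. *)
Lemma expectation_state_ge c :
  (M%:R^-1 ^+ k * 4%:R ^+ (k * h) : C) <=
  \sum_b \sum_b' (test c b)^* * ent (tens_pow k state) b b' * test c b'.
Proof.
pose ov (i : {ffun 'I_k -> 'I_M}) :=
  \sum_b (test c b)^* * \prod_a amps (i a) (copyA b a) (copyB b a).
have -> : \sum_b \sum_b' (test c b)^* * ent (tens_pow k state) b b' * test c b' =
   (M * 4 ^ h)%:R^-1 ^+ k * \sum_i `|ov i| ^+ 2.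
  under [in RHS]eq_bigr do rewrite normCK /ov rmorph_sum big_distrlr /=.
  rewrite [in RHS]exchange_big big_distrr /=; apply: eq_bigr => b _.
  rewrite [in RHS]exchange_big big_distrr /=; apply: eq_bigr => b' _.
  rewrite ent_tens_pow_state copies_sum mulrCA -mulrA; congr (_ * _).
  rewrite big_distrr big_distrl /=; apply: eq_bigr => i _.
  by rewrite rmorphM /= conjCK; ring.
have card_Bk : #|{: Bk}| = (4 ^ (k * h))%N.
  by rewrite card_prod !card_bits card_prod !card_ord -expnMn.
have ovc : ov [ffun=> c] = (4 ^ (k * h))%:R.
  rewrite /ov -card_Bk -sumr_const; apply: eq_bigr => b _.
  under [X in _ * X]eq_bigr do rewrite ffunE.
  by rewrite mulrC -normCK test_norm expr1n.
have -> : M%:R^-1 ^+ k * 4%:R ^+ (k * h) =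
   (M * 4 ^ h)%:R^-1 ^+ k * `|ov [ffun=> c]| ^+ 2 :> C.
  rewrite ovc normr_nat natrM invfM exprMn -mulrA; congr (_ * _).
  have -> : (4 ^ h)%:R^-1 ^+ k = (4%:R ^+ (k * h))^-1 :> C.
    by rewrite natrX exprVn -exprM mulnC.
  by rewrite natrX expr2 mulKf // expf_neq0 // pnatr_eq0.
rewrite ler_wpM2l ?exprn_ge0 ?invr_ge0 ?ler0n //.
rewrite (bigD1 [ffun=> c]) //= lerDl.
by apply: sumr_ge0 => i _; rewrite exprn_ge0.
Qed.

Lemma Hmin_state_le (m : nat) : M = (2 ^ m)%N ->
  (Hmin (tens_pow k state) <= (- (k%:R * (h%:R - m%:R)))%:E)%E.
Proof.
move=> Mm; pose c := Ordinal M0.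
(* Here [mu = 2^(k h)] by [test_orth], and [M^-k 4^(k h)] equals [2^(k (h - m)) mu] exactly, so no
   error term arises. *)
apply: (@Hmin_le _ _ _ _ (test c) (2 ^+ (k * h))); first by rewrite exprn_gt0.
  by move=> y y'; rewrite test_orth natrX rmorphXn rmorphMn /=.
apply: le_trans (expectation_state_ge c).
have -> : 2 `^ (k%:R * (h%:R - m%:R)) = 2 ^+ (k * h) / 2 ^+ (k * m) :> R.
  by rewrite mulrBr powRB ?pnatr_eq0 ?implybT // -!natrM !powR_mulrn.
have -> : M%:R^-1 ^+ k * 4%:R ^+ (k * h) =
    (2 ^+ (k * h) / 2 ^+ (k * m) * 2 ^+ (k * h))%:C.
  rewrite Mm natrX -exprVn -exprM mulnC !rmorphM fmorphV /= !rmorphXn !rmorphMn /=.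
  by rewrite -[4%:R]/((2 * 2)%:R) natrM exprMn exprVn [(k * m)%N]mulnC; ring.
by [].
Qed.

End State.

(** * Choice of parameters and existence of good phases *)

Section Existence.
Variable R : realType.
Local Notation C := R[i].
Local Notation "x %:C" := (real_complex R x).

Lemma expR1_le4 : expR 1 <= 4 :> R.
Proof.
have half : expR (- 2^-1) >= 2^-1 :> R.
  by apply: le_trans (expR_ge1Dx _); lra.
have -> : 4 = (2^-1 * 2^-1)^-1 :> R by field.
have -> : expR 1 = (expR (- 2^-1) * expR (- 2^-1))^-1 :> R.
  by rewrite -expRD -expRN; congr expR; field.
by rewrite lef_pV2 ?posrE ?mulr_gt0 ?expR_gt0 // ler_pM.
Qed.

(** With [K = q k], [(1 + K^2/M)^K <= exp(K^3/M)], and [q^4 <= M] gives [K^3/M <= k^3]. Then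
    [e <= 4] accounts for [2^(2 k^3)], and the extra 1 in the exponent for strictness. *)
Lemma moment_constant_lt (M q k : nat) : (0 < q)%N -> (q ^ 4 <= M)%N ->
  ((M + (q * k) ^ 2) ^ (q * k) < M ^ (q * k) * 2 ^ (2 * k ^ 3 + 1))%N.
Proof.
move=> q0 qM; have M0 : (0 < M)%N by apply: leq_trans qM; rewrite expn_gt0 q0.
set K := (q * k)%N; have MR : 0 < M%:R :> R by rewrite ltr0n.
suff : (M + K ^ 2)%:R ^+ K <= M%:R ^+ K * 4 ^+ (k ^ 3) :> R.
  rewrite -!natrX -natrM ler_nat => /leq_ltn_trans; apply.
  rewrite ltn_pmul2l ?expn_gt0 ?M0 // expnD expnM muln2 -addnn -[X in (X < _)%N]addn0.
  by rewrite ltn_add2l expn_gt0.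
have -> : (M + K ^ 2)%:R = M%:R * (1 + (K ^ 2)%:R / M%:R) :> R.
  by rewrite natrD; field; rewrite gt_eqF.
rewrite exprMn ler_pM2l ?exprn_gt0 //.
apply: (@le_trans _ _ (expR ((K ^ 2)%:R / M%:R) ^+ K)).
  by rewrite lerXn2r ?nnegrE ?expR_ge0 ?expR_ge1Dx // addr_ge0 // divr_ge0.
rewrite -expRM_natl.
apply: (@le_trans _ _ (expR ((k ^ 3)%:R * 1))).
  rewrite ler_expR mulr1 mulrA ler_pdivrMr // -!natrM ler_nat.
  apply: leq_trans (leq_mul (leqnn (k ^ 3)) qM).
  have -> : (K * K ^ 2 = k ^ 3 * q ^ 3)%N by rewrite -expnS /K expnMn mulnC.
  by rewrite leq_mul2l leq_pexp2l // orbT.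
by rewrite expRM_natl lerXn2r ?nnegrE ?expR_ge0 ?expR1_le4.
Qed.

Variables (I : finType) (G : I -> gate R) (a : nat).
Hypothesis arity_le : forall i, (arity (G i) <= a)%N.

(** [S] strictly above the bound yields an actual circuit straight from the infimum. *)
Lemma complexity_lt (WA WB : finType) (T : op R (bits WB) (bits WB) -> op R (bits WA) (bits WA))
    (bound : R) (S : nat) :
  (complexity G T <= bound%:E)%E -> bound < S%:R ->
  exists2 c : circuit G WB WA, (size (gates c) <= S)%N & forall rho, T rho = circuit_map c rho.
Proof.
move=> Tb bS; have : (complexity G T < S%:R%:E)%E by rewrite (le_lt_trans Tb) // lte_fin.
by move=> /ereal_inf_lt[_ [c Tc <-]]; rewrite lte_fin ltr_nat => /ltnW cS; exists c.
Qed.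

(* The exponent of [channel_count] for registers of [w] qubits. *)
Definition channel_bits (S w : nat) : nat :=
  (S * (1 + #|I| + a * (w + (S * a + w)).+1) + (w + (S * a + w)) * w)%N.

Lemma state_exists (h k S m : nat) (bound : R) : bound < S%:R ->
  exists rho : op R (bits 'I_h * bits 'I_h)%type (bits 'I_h * bits 'I_h)%type,
    [/\ density rho,
      (Hmin (tens_pow k rho) <= (- (k%:R * (h%:R - m%:R)))%:E)%E &
      ((k%:R * h%:R - (channel_bits S (k * h) + (2 * k ^ 3 + 1))%:R / (2 ^ (m %/ 4))%:R)%:E
        <= comp_Hmin G bound (tens_pow k rho))%E].
Proof.
move=> boundS.
(* [q] is the largest power of two with [q^4 <= M]. *)
set Q := channel_bits S (k * h); set q := (2 ^ (m %/ 4))%N; pose M := (2 ^ m)%N.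
set eps := _ / q%:R.
have q0 : (0 < q)%N by rewrite expn_gt0.
have M0 : (0 < M)%N by rewrite expn_gt0.
have qM : (q ^ 4 <= M)%N by rewrite /q /M -expnM leq_exp2l // leq_trunc_div.
(* The order [q k + 1] of [w] exceeds the number [q k] of copies that enter the moment. *)
have r0 : (0 < (q * k).+1)%N by [].
have [w wr] := prim_root_exists C r0.
have [T [F [cardT FT]]] := channel_count arity_le ('I_k * 'I_h)%type ('I_k * 'I_h)%type S.
rewrite !card_prod !card_ord -/(channel_bits S (k * h)) -/Q in cardT.
(* Keeps the codes that stand for a circuit and have the partial trace of a channel; the latter
   fixes the trace of [F j] to [2^(k h)]. *)
pose good j := `[< exists2 c : circuit G ('I_k * 'I_h)%type ('I_k * 'I_h)%type,
  F j =2 gram (@circuit_amp R I G _ _ c) &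
  forall b b', \sum_x F j (x, b) (x, b') = (b == b')%:R >].
(* Dividing by the normalisation [(M 4^h)^k] turns [beta] into [2^(-k h) 2^eps], while [eps] makes
   [beta^q] absorb the number of channels and the moment constant. *)
pose beta : R := (M * 2 ^ h)%:R ^+ k * 2 `^ eps.
have beta_q : beta%:C ^+ q = (M ^ (q * k) * 2 ^ (h * (q * k)) * 2 ^ (Q + (2 * k ^ 3 + 1)))%:R.
  rewrite -rmorphXn /= /beta exprMn -exprM.
  have -> : (2 `^ eps) ^+ q = 2 ^+ (Q + (2 * k ^ 3 + 1)) :> R.
    rewrite -powR_mulrn ?powR_ge0 // -powRrM /eps divfK ?powR_mulrn //.
    by rewrite pnatr_eq0 -lt0n.
  have -> : (M ^ (q * k) * 2 ^ (h * (q * k)) = (M * 2 ^ h) ^ (k * q))%N.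
    by rewrite expnMn -expnM [(k * q)%N]mulnC.
  by rewrite -!natrX -natrM rmorph_nat.
have small : #|T|%:R * (((M + (q * #|'I_k|) ^ 2) ^ (q * #|'I_k|))%:R * (2 ^ (k * h))%:R ^+ q)
     < beta%:C ^+ q.
  rewrite beta_q card_ord -natrX -!natrM ltr_nat.
  have -> : ((2 ^ (k * h)) ^ q = 2 ^ (h * (q * k)))%N by rewrite -expnM; congr expn; lia.
  apply: leq_ltn_trans (leq_mul cardT (leqnn _)) _.
  rewrite expnD [X in (_ < X)%N]mulnCA ltn_pmul2l ?expn_gt0 // mulnAC.
  by rewrite ltn_pmul2r ?expn_gt0 // moment_constant_lt.
have [s sP] : exists s : phases (bits 'I_h) (bits 'I_h) M (q * k).+1, forall j, good j ->
    \sum_b \sum_b' copies (@chi C h) w (@copyA h k) (@copyB h k) s b b' * F j b' b <= beta%:C.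
  apply: (good_phases (@chi_norm C h) wr (@copy_inj h k) _ _ _ _ _ small).
  - move=> j /asboolP[c Fc _]; exists (bits 'I_(nK c)).
    by exists (@circuit_amp R I G _ _ c); exact: Fc.
  - move=> j /asboolP[c _ Fb]; rewrite sum_pair exchange_big /=.
    under eq_bigr do rewrite Fb eqxx.
    by rewrite sumr_const card_bits card_prod !card_ord.
  - exact: ler0n.
  - by rewrite -[0]/(0%:C) ler_real_complex mulr_ge0 ?exprn_ge0 ?powR_ge0.
  - by rewrite card_ord.
exists (state w s); split.
- exact: state_density.
- exact: (Hmin_state_le wr r0 M0).
apply: cone_Hmin_ge.
- by rewrite card_bits expn_gt0.
- move=> _ [T0 [[_ _ trT] cT] <-].
  have [c cS Tc] := complexity_lt cT boundS.
  have [j Fj] := FT c cS.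
  have FJ b b' : ent (choi_adjoint T0) b b' = F j b b' by rewrite (choi_circuit Tc) Fj.
  rewrite trace_tens_pow_state.
  under eq_bigr do under eq_bigr do rewrite FJ.
  have gj : good j.
    apply/asboolP; exists c => // b b'; rewrite -(choi_trace b b' trT).
    by apply: eq_bigr => x _; rewrite FJ.
  apply: le_trans (ler_wpM2l _ (sP j gj)) _; first by rewrite exprn_ge0 // invr_ge0 ler0n.
  have -> : 2 `^ (- (k%:R * h%:R - eps)) = (2 ^+ (k * h))^-1 * 2 `^ eps :> R.
    by rewrite opprB addrC powRD ?pnatr_eq0 ?implybT // powRN -natrM powR_mulrn.
  rewrite -(rmorph_nat (real_complex R)) -fmorphV -rmorphXn -rmorphM /= ler_real_complex.
  rewrite le_eqVlt; apply/orP; left; apply/eqP.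
  rewrite /beta mulrA; congr (_ * _).
  have -> : (M * 4 ^ h = M * 2 ^ h * 2 ^ h)%N by rewrite -mulnA -expnMn.
  rewrite natrM invfM exprMn mulrAC -exprMn mulVf ?expr1n ?mul1r; last first.
    by rewrite pnatr_eq0 -lt0n muln_gt0 M0 expn_gt0.
  by rewrite natrX exprVn -exprM mulnC.
by move=> _ sigma [T0 [[_ _ trT] _] <-]; exact: trace_tens1_choi.
Qed.

End Existence.

(** * Asymptotics *)

Definition power_bounded (f : nat -> nat) : Prop :=
  exists A D, forall n, (f n <= A * n.+1 ^ D)%N.

Lemma power_bounded_cst c : power_bounded (fun=> c).
Proof. by exists c, 0%N => n; rewrite muln1. Qed.

Lemma power_bounded_half : power_bounded half.
Proof. by exists 1%N, 1%N => n; rewrite mul1n expn1; lia. Qed.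

Lemma power_boundedM f g : power_bounded f -> power_bounded g ->
  power_bounded (fun n => (f n * g n)%N).
Proof.
move=> [A [D hf]] [A' [D' hg]]; exists (A * A')%N, (D + D')%N => n.
by rewrite expnD mulnACA leq_mul.
Qed.

Lemma power_boundedD f g : power_bounded f -> power_bounded g ->
  power_bounded (fun n => (f n + g n)%N).
Proof.
move=> [A [D hf]] [A' [D' hg]]; exists (A + A')%N, (D + D')%N => n.
rewrite mulnDl leq_add //.
  by apply: leq_trans (hf n) _; rewrite leq_mul2l leq_pexp2l ?leq_addr ?orbT.
by apply: leq_trans (hg n) _; rewrite leq_mul2l leq_pexp2l ?leq_addl ?orbT.
Qed.

Lemma power_bounded_horner (k : nat -> nat) : poly_bounded k -> power_bounded k.
Proof.
move=> [q kq]; exists (\sum_(i < size q) (q`_i)%R)%N, (size q) => n.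
apply: leq_trans (kq n) _; rewrite horner_coef big_distrl /=; apply: leq_sum => i _.
rewrite leq_mul2l; apply/orP; right.
apply: (@leq_trans (n.+1 ^ i)%N); last by rewrite leq_pexp2l // ltnW.
have -> : n ^+ i = (n ^ i)%N by elim: (nat_of_ord i) => // j; rewrite exprS expnS => ->.
exact: leq_exp2rW.
Qed.

(** The absolute values of the coefficients bound [p]; rounding their sum up strictly provides the
    [S] that [state_exists] asks for. *)
Lemma power_bound_poly (R : realType) (p : {poly R}) :
  exists2 S : nat -> nat, power_bounded S & forall n, p.[n%:R] < (S n)%:R.
Proof.
pose A := \sum_(i < size p) `|p`_i|.
have A0 : 0 <= A by apply: sumr_ge0.
exists (fun n => (Num.truncn A).+1 * n.+1 ^ size p)%N; first by exists (Num.truncn A).+1, (size p).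
move=> n; rewrite natrM natrX.
apply: (@le_lt_trans _ _ (A * n.+1%:R ^+ size p)); last first.
  by rewrite ltr_pM2r ?exprn_gt0 // truncnS_gt.
rewrite horner_coef big_distrl /=; apply: ler_sum => i _.
apply: le_trans (ler_norm _) _; rewrite normrM ler_wpM2l // normrX normr_nat.
apply: (@le_trans _ _ (n.+1%:R ^+ i)); first by rewrite lerXn2r ?nnegrE // ler_nat.
by rewrite ler_weXn2l ?ler1n // ltnW.
Qed.

Section Negligible.
Variables (R : realType) (m : nat -> nat).
Hypothesis hm : (fun a : nat => (m a)%:R / log2 (a%:R : R)) @ \oo --> +oo.

Lemma superpoly (N : nat) :
  \forall a \near \oo, (a ^ N <= 2 ^ m a)%N.
Proof.
have : \forall a \near \oo, (N%:R : R) <= (m a)%:R / log2 (a%:R : R).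
  by move/cvgryPge: hm; apply.
apply: filter_app; exists 2%N => // a /= a2 ha.
have l2 : 0 < ln 2 :> R by rewrite ln_gt0 // ltr1n.
have la : 0 < ln a%:R :> R by rewrite ln_gt0 // ltr1n.
have a0 : 0 < a%:R :> R by rewrite ltr0n ltnW.
move: ha; rewrite /log2 ler_pdivlMr ?divr_gt0 // mulrA ler_pdivrMr //.
rewrite !mulr_natl -(lnXn _ a0) -lnXn // ler_ln ?posrE ?exprn_gt0 //.
by rewrite -!natrX ler_nat.
Qed.

(** Passing from [n./2] to [n] costs a cube, since [n <= (n./2)^3] for [n >= 4], and the division by
    4 a fourth power; the factor 2 absorbs its rounding. *)
Lemma superpoly_half (N : nat) :
  \forall n \near \oo, (n ^ N <= 2 * 2 ^ (m n./2 %/ 4))%N.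
Proof.
have [a0 _ h] := superpoly (N * 3 * 4).
exists (a0.*2 + 4)%N => // n /= hn.
have a0n : (a0 <= n./2)%N by lia.
have := h _ a0n; set a := n./2 => le.
have na : (n <= a ^ 3)%N.
  have a2 : (2 <= a)%N by rewrite /a; lia.
  have : (n <= 2 * a + 1)%N by rewrite /a; lia.
  move=> /leq_trans; apply; rewrite !expnS expn0 muln1; nia.
have : ((n ^ N) ^ 4 <= (2 * 2 ^ (m a %/ 4)) ^ 4)%N.
  apply: (@leq_trans (2 ^ m a)); last first.
    rewrite -expnS -expnM leq_exp2l //; lia.
  apply: leq_trans le; rewrite -!expnM [(N * 4)%N]mulnC.
  rewrite [(N * 3 * 4)%N](_ : _ = 3 * (4 * N))%N; last by lia.
  by rewrite [leqRHS]expnM leq_exp2rW.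
by rewrite leq_exp2r.
Qed.

Lemma negl_power_bounded (f : nat -> nat) : power_bounded f ->
  negl (fun n => (f n)%:R / (2 ^ (m n./2 %/ 4))%:R : R).
Proof.
move=> [A [D fAD]] c; pose c' := (Num.truncn `|c|).+1.
have cc' : c <= c'%:R by apply: le_trans (ler_norm _) _; apply/ltW/truncnS_gt.
(* [2^D] and one 2 come from [n + 1 <= 2 n], the other 2 from [superpoly_half]. *)
pose K := (A * 2 ^ D * 2 * 2)%N.
apply: (@squeeze_cvgr _ _ _ _ (fun=> 0) (fun n => K%:R * harmonic n)); last first.
- by rewrite -[X in _ --> X](mulr0 K%:R); apply: cvgM; [exact: cvg_cst|exact: cvg_harmonic].
- exact: cvg_cst.
(* The exponent covers [n^D] from [f], the factor [n^c'], and one more power for the comparison with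
   [1/(n+1)]. *)
have := superpoly_half (D + c' + 1); apply: filter_app.
exists 1%N => // n /= n1 hn.
rewrite mulr_ge0 ?powR_ge0 ?divr_ge0 //=.
apply: (@le_trans _ _ ((f n)%:R / (2 ^ (m n./2 %/ 4))%:R * n%:R ^+ c')).
  rewrite ler_wpM2l ?divr_ge0 // -powR_mulrn //.
  by rewrite ler_powR // ler1n.
rewrite /harmonic /= ler_pdivlMr // -[leLHS]mulrA [leLHS]mulrAC ler_pdivrMr ?ltr0n ?expn_gt0 //.
rewrite -natrX -!natrM ler_nat /K.
have fn : (f n <= A * 2 ^ D * n ^ D)%N.
  apply: leq_trans (fAD n) _; rewrite -mulnA leq_mul2l -expnMn; apply/orP; right.
  by apply: leq_exp2rW; lia.
have n2 : (n.+1 <= 2 * n)%N by lia.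
have h1 : (f n * n.+1 * n ^ c' <= A * 2 ^ D * n ^ D * (2 * n) * n ^ c')%N.
  by rewrite !leq_mul.
apply: (@leq_trans (A * 2 ^ D * n ^ D * (2 * n) * n ^ c')%N).
  by rewrite [(n ^ c' * _)%N]mulnC mulnA.
have -> : (A * 2 ^ D * n ^ D * (2 * n) * n ^ c' = A * 2 ^ D * 2 * n ^ (D + c' + 1))%N.
  by rewrite !expnD expn1; ring.
by rewrite -[leqRHS]mulnA leq_mul2l hn orbT.
Qed.

End Negligible.

Lemma power_bounded_channel_bits (I : finType) a (S w : nat -> nat) :
  power_bounded S -> power_bounded w ->
  power_bounded (fun n => channel_bits I a (S n) (w n)).
Proof.
move=> hS hw; pose c := power_bounded_cst.
have hL : power_bounded (fun n => w n + (S n * a + w n))%N.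
  by do ![apply: power_boundedD|apply: power_boundedM].
rewrite /channel_bits.
under eq_fun do rewrite -[X in (a * X)%N]addn1.
by do ![apply: power_boundedD|apply: power_boundedM].
Qed.

Theorem mainTheorem6 (R : realType)
    (I : finType) (G : I -> gate R) (p : {poly R})
    (hspan : forall n : nat, ~~ odd n ->
       spanning G p.[n%:R] 'I_(n./2) 'I_(n./2))
    (m k : nat -> nat)
    (hm : (fun a : nat => (m a)%:R / log2 (a%:R : R)) @ \oo --> +oo)
    (hk : poly_bounded k) :
  exists rho : forall n : nat,
      op R (bits 'I_(n./2) * bits 'I_(n./2))%type
           (bits 'I_(n./2) * bits 'I_(n./2))%type,
    (forall n : nat, ~~ odd n -> density (rho n)) /\
    exists eps1 eps2 : nat -> R,
      [/\ negl eps1, negl eps2 &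
        forall n : nat, ~~ odd n ->
          (Hmin (tens_pow (k n) (rho n)) <=
             (- ((k n)%:R * ((n./2)%:R - (m n./2)%:R)) + eps1 n)%:E)%E /\
          (((k n)%:R * (n./2)%:R - eps2 n)%:E <=
             comp_Hmin G p.[n%:R] (tens_pow (k n) (rho n)))%E].
Proof.
pose a := \max_i arity (G i).
have arity_le i : (arity (G i) <= a)%N by apply: leq_bigmax.
have [S hS pS] := power_bound_poly p.
have H n := state_exists arity_le n./2 (k n) (m n./2) (pS n).
exists (fun n => sval (cid (H n))); split=> [n _|]; first by case: (cid (H n)) => ? [].
(* The min-entropy bound of [state_exists] is exact, so [eps1] is zero; [eps2] is its error
   [eps]. *)
exists (fun=> 0), (fun n => (channel_bits I a (S n) (k n * n./2) + (2 * k n ^ 3 + 1))%:R /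
  (2 ^ (m n./2 %/ 4))%:R); split.
- by move=> c; under eq_fun do rewrite mul0r; exact: cvg_cst.
- apply: (negl_power_bounded hm); have hk' := power_bounded_horner hk.
  have c := power_bounded_cst.
  apply: power_boundedD.
    apply: power_bounded_channel_bits => //; apply: power_boundedM => //.
    exact: power_bounded_half.
  apply: power_boundedD => //; apply: power_boundedM => //.
  under eq_fun do rewrite !expnS expn0.
  by do ![apply: power_boundedM].
by move=> n _; case: (cid (H n)) => rho [_ hH hC] /=; rewrite addr0.
Qed.
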